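(* Let $(\mathcal R,\Lambda,S)$ be a generalized Renner-Coxeter system with $\mathcal R$ finite, with group of units $W$ and longest element $w_0\in W$, and put $\Lambda^-=w_0\Lambda w_0$. Let $\varepsilon=+$ or $-$. Define the following subsets of $\mathcal R$: $\mathcal{GJ}^{\varepsilon}=\{r\in\mathcal R\mid r=\min^{\varepsilon}L_r\}$, $\mathcal{JG}^{\varepsilon}=\{r\in\mathcal R\mid r=\min^{\varepsilon}R_r\}$, $\mathcal N^{\varepsilon}=\{r\in\mathcal R\mid r=\min^{\varepsilon}J_r\}$, $\mathcal O^{\varepsilon}=\{r\in\mathcal R\mid r=\min^{\varepsilon}H_r\}$. Then: (1) $\mathcal O^{+}=\mathcal O^{-}$; denote this set by $\mathcal O$. (2) $\mathcal N^{\varepsilon}=\mathcal{GJ}^{\varepsilon}\cap\mathcal{JG}^{\varepsilon}$. (3) Each of these sets is a monoid. (4) $\mathcal{GJ}^{+}=(\mathcal{JG}^{-})^{*}$ and $\mathcal{JG}^{+}=(\mathcal{GJ}^{-})^{*}$. (5) $\mathcal O$ is the smallest monoid containing $\mathcal{GJ}^{\varepsilon}$ and $\mathcal{JG}^{\varepsilon}$. (6) $\mathcal O$ is the smallest inverse monoid containing $\mathcal{GJ}^{\varepsilon}$. (7) $\mathcal O$ is the smallest inverse monoid containing $\mathcal{JG}^{\varepsilon}$. (8) $w_0\mathcal{GJ}^{\varepsilon}=\{r\in\mathcal R\mid r=\max^{\varepsilon}L_r\}$. (9) $\mathcal{JG}^{\varepsilon}w_0=\{r\in\mathcal R\mid r=\max^{\varepsilon}R_r\}$.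 (10) $w_0\Lambda=\Lambda^-w_0=\{r\in\mathcal R\mid r=\max^{+}J_r\}$ and $w_0\Lambda^-=\Lambda w_0=\{r\in\mathcal R\mid r=\max^{-}J_r\}$. (11) $w_0\mathcal O=\mathcal Ow_0=\{r\in\mathcal R\mid r=\max^{\varepsilon}H_r\}$ for each $\varepsilon$. (12) $\mathcal N^{\varepsilon}\cong\mathcal R/\mathscr J$, $\mathcal{GJ}^{\varepsilon}\cong\mathcal R/\mathscr L$, $\mathcal{JG}^{\varepsilon}\cong\mathcal R/\mathscr R$, $\mathcal O\cong\mathcal R/\mathscr H$, in the sense that each class of the relation contains exactly one element of the respective set.
   Context: For a Coxeter system $(W,S)$, $\leq$ is the Bruhat order. For $I\subseteq S$, $W_I$ is the subgroup generated by $I$; $W^I$ (resp. ${}^IW$) is the set of $w\in W$ that are the Bruhat-minimum of $wW_I$ (resp. $W_Iw$). A generalized Renner-Coxeter system is a triple $(\mathcal R,\Lambda,S)$ such that: (i) $\mathcal R$ is a factorizable monoid with group of units $W$, i.e. $\mathcal R=E(\mathcal R)W=WE(\mathcal R)$, where the set $E(\mathcal R)$ of idempotents is a meet semilattice under $e\leq f\Leftrightarrow ef=fe=e$ (thus $\mathcal R$ is an inverse monoid); (ii) $\Lambda$ is a transversal of $E(\mathcal R)$ for the conjugation action of $W$ and a sub-meet semilattice; (iii) $(W,S)$ is a Coxeter system; (iv) for every $e\leq e'$ in $E(\mathcal R)$ there are $w\in W$ and $f\leq f'$ in $\Lambda$ with $wew^{-1}=f$, $we'w^{-1}=f'$; (v)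 the map $\lambda^*(e)=\{s\in S\mid se=es\neq e\}$ on $\Lambda$ satisfies $e\leq f\Rightarrow\lambda^*(e)\subseteq\lambda^*(f)$; (vi) for every $e\in\Lambda$, $\{w\in W\mid we=ew\}$ and $\{w\in W\mid we=ew=e\}$ are standard parabolic subgroups of $W$. The subsets $\lambda(e),\lambda_*(e)\subseteq S$ are defined by $W_{\lambda(e)}=\{w\in W\mid we=ew\}$ and $W_{\lambda_*(e)}=\{w\in W\mid we=ew=e\}$. Each $r\in\mathcal R$ has a unique left standard form $r=xey$ ($e\in\Lambda$, $x\in W^{\lambda_*(e)}$, $y\in{}^{\lambda(e)}W$) and a unique right standard form $r=yex$ ($e\in\Lambda$, $y\in W^{\lambda(e)}$, $x\in{}^{\lambda_*(e)}W$). Adherence orders: if $r=xey$, $s=afb$ are in left standard form, $r\leq^{+}s$ iff $e\leq f$ and there is $w\in W_{\lambda^*(f)}W_{\lambda_*(e)}$ with $x\leq aw$ and $w^{-1}b\leq y$. If $r=yex$, $s=bfa$ are in right standard form, $r\leq^{-}s$ iff $e\leq f$ and there is $w\in W_{\lambda_*(e)}W_{\lambda^*(f)}$ with $x\leq wa$ and $bw^{-1}\leq y$. Green's relations: $r\mathscr Js$ iff $\mathcal Rr\mathcal R=\mathcal Rs\mathcal R$ (iff $WrW=WsW$); $r\mathscr Ls$ iff $\mathcal Rr=\mathcal Rs$ (iff $Wr=Ws$); $r\mathscr Rs$ iff $r\mathcal R=s\mathcal R$ (iff $rW=sW$); $\mathscr H=\mathscr L\cap\mathscr R$. $J_r,L_r,R_r,H_r$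 are the classes of $r$. For a class $T_r$, $\max^{\varepsilon}T_r$ (resp. $\min^{\varepsilon}T_r$) is the element $s\in T_r$ with $t\leq^{\varepsilon}s$ (resp. $s\leq^{\varepsilon}t$) for all $t\in T_r$, if it exists. $r^*$ is the unique inverse of $r$ ($rr^*r=r$, $r^*rr^*=r^*$), and $X^*=\{r^*\mid r\in X\}$.
   Formalization: Item (5) fails for a single fixed sign ε (e.g. rook monoid of degree 2); it is replaced by: O is the smallest monoid containing GJ^ε and JG^ε for both signs ε together, and, for each ε, the smallest monoid containing GJ^ε and JG^{-ε}. *)

(* Defs.v *)
From HB Require Import structures.
From mathcomp Require Import all_boot fingroup.

Set Implicit Arguments.
Unset Strict Implicit.
Unset Printing Implicit Defensive.

Local Open Scope group_scope.

(* A hand-packed structure: MathComp has finStarMonoidType but no plain finite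
   monoid, and Hierarchy Builder cannot insert one below it afterwards. *)
Record finMonoidType := FinMonoid {
  fin_monoid_base : finType;
  fin_monoid_mul : fin_monoid_base -> fin_monoid_base -> fin_monoid_base;
  fin_monoid_one : fin_monoid_base;
  fin_monoid_mulA : associative fin_monoid_mul;
  fin_monoid_mul1 : left_id fin_monoid_one fin_monoid_mul;
  fin_monoid_mulr1 : right_id fin_monoid_one fin_monoid_mul
}.

Definition fin_monoid_sort (M : finMonoidType) : Type := fin_monoid_base M.
Coercion fin_monoid_sort : finMonoidType >-> Sortclass.

HB.instance Definition _ (M : finMonoidType) :=
  Finite.copy (fin_monoid_sort M) (fin_monoid_base M).
HB.instance Definition _ (M : finMonoidType) :=
  isMonoid.Build (fin_monoid_sort M)
    (@fin_monoid_mulA M) (@fin_monoid_mul1 M) (@fin_monoid_mulr1 M).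

Section Units.
Variable R : finMonoidType.
Implicit Types x y : R.

Definition two_sided_inverse x y := (x * y == 1) && (y * x == 1).

Definition invertible x := [exists y, two_sided_inverse x y].

Record units_of := Units {uval : R; uvalP : invertible uval}.

HB.instance Definition _ := [isSub for uval].
#[hnf] HB.instance Definition _ := [Finite of units_of by <:].

Lemma invertible1 : invertible 1.
Proof. by apply/existsP; exists 1; rewrite /two_sided_inverse mulg1 eqxx. Qed.

Lemma invertibleM x y : invertible x -> invertible y -> invertible (x * y).
Proof.
move=> /existsP[x' /andP[/eqP xx' /eqP x'x]].
move=> /existsP[y' /andP[/eqP yy' /eqP y'y]].
apply/existsP; exists (y' * x'); apply/andP; split; apply/eqP.
  by rewrite -mulgA (mulgA y) yy' mul1g.
by rewrite -mulgA (mulgA x') x'x mul1g.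
Qed.

Definition inverse x := odflt x [pick y | two_sided_inverse x y].

Lemma inverseP x : invertible x -> two_sided_inverse x (inverse x).
Proof.
move=> /existsP[y xy]; rewrite /inverse.
by case: pickP => [//|/(_ y)]; rewrite xy.
Qed.

Lemma invertibleV x : invertible x -> invertible (inverse x).
Proof.
move=> /inverseP/andP[xx' x'x]; apply/existsP; exists x.
by rewrite /two_sided_inverse x'x xx'.
Qed.

Definition units_one := Units invertible1.
Definition units_mul (u v : units_of) := Units (invertibleM (uvalP u) (uvalP v)).
Definition units_inv (u : units_of) := Units (invertibleV (uvalP u)).

Lemma units_mulA : associative units_mul.
Proof. by move=> u v w; apply: val_inj; rewrite /= mulgA. Qed.

Lemma units_mul1 : left_id units_one units_mul.
Proof. by move=> u; apply: val_inj; rewrite /= mul1g. Qed.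

Lemma units_mulV : left_inverse units_one units_inv units_mul.
Proof.
by move=> u; apply: val_inj => /=; case/andP: (inverseP (uvalP u)) => _ /eqP.
Qed.

HB.instance Definition _ :=
  Finite_isGroup.Build units_of units_mulA units_mul1 units_mulV.

End Units.

Coercion uval : units_of >-> fin_monoid_sort.

Section Coxeter.
Variables (gT : finGroupType) (S : {set gT}).
Implicit Types (u v w : gT) (I : {set gT}).

(* W has the presentation < S | (st)^m(s,t) = 1 >, m(s,t) being the order of st
   in W; being a presentation is expressed by the universal property. Only the
   values of f on S matter. *)
Definition coxeter_system : Prop :=
  [/\ <<S>> = [set: gT],
      {in S, forall s, #[s] = 2}
    & forall (H : groupType) (f : gT -> H),
        {in S &, forall s t, (f s * f t) ^+ #[s * t] = 1} ->
        exists2 g : gT -> H, {morph g : x y / x * y} & {in S, g =1 f}].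

(* S ^+ n is the set of products of n elements of S. If S generates gT, the
   minimal n with w \in S ^+ n exists and is smaller than #|gT|. *)
Definition length w : nat := find (fun n => w \in S ^+ n) (iota 0 #|gT|).

Definition longest w : Prop := forall v, length v <= length w.

Definition reflections : {set gT} := [set s ^ w | s in S, w in [set: gT]].

Definition bruhat : rel gT :=
  connect (fun u v => [exists t in reflections,
                         (v == u * t) && (length u < length v)]).

Definition standard_parabolic (P : {set gT}) : Prop :=
  exists2 I : {set gT}, I \subset S & P = <<I>>.

(* W^I and {}^I W in the usual notation. *)
Definition min_lcosets I : {set gT} :=
  [set w | [forall v in w *: <<I>>, bruhat w v]].
Definition min_rcosets I : {set gT} :=
  [set w | [forall v in <<I>> :* w, bruhat w v]].

End Coxeter.

Section FinMonoidTheory.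
Variable R : finMonoidType.
Implicit Types (e f g r s t : R) (X M : {set R}).

Definition idempotents : {set R} := [set e : R | e * e == e].

Definition idem_le e f := (e * f == e) && (f * e == e).

Definition is_meet e f g : Prop :=
  [/\ g \in idempotents, idem_le g e, idem_le g f
    & forall h, h \in idempotents -> idem_le h e -> idem_le h f -> idem_le h g].

(* The meet is the product. For arbitrary poset meets the idempotents need not
   commute: see the band {1, e, f, 0} with ef = e and fe = f. *)
Definition idempotents_meet_semilattice : Prop :=
  {in idempotents &, forall e f, is_meet e f (e * f)}.

Definition factorizable : Prop :=
  forall r,
    (exists e (w : units_of R), e \in idempotents /\ r = e * uval w) /\
    (exists e (w : units_of R), e \in idempotents /\ r = uval w * e).

Definition weak_inverse r s := (r * s * r == r) && (s * r * s == s).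

Definition star r : R := odflt r [pick s | weak_inverse r s].

Definition submonoid M : Prop := monoid_closed M.

Definition inverse_submonoid M : Prop :=
  submonoid M /\
  {in M, forall r, exists! s, s \in M /\ weak_inverse r s}.

Definition smallest (P : {set R} -> Prop) M : Prop :=
  P M /\ forall M', P M' -> M \subset M'.

Definition greenJ : rel R := fun r s =>
  [set u * r * v | u : R, v : R] == [set u * s * v | u : R, v : R].
Definition greenL : rel R := fun r s =>
  [set u * r | u : R] == [set u * s | u : R].
Definition greenR : rel R := fun r s =>
  [set r * u | u : R] == [set s * u | u : R].
Definition greenH : rel R := fun r s => greenL r s && greenR r s.

Definition class_of (G : rel R) r : {set R} := [set s : R | G r s].

Definition mins (le G : rel R) : {set R} :=
  [set r : R | [forall t in class_of G r, le r t]].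
Definition maxs (le G : rel R) : {set R} :=
  [set r : R | [forall t in class_of G r, le t r]].

Definition ltrans (w : R) X : {set R} := [set w * r | r : R in X].
Definition rtrans X (w : R) : {set R} := [set r * w | r : R in X].

Definition class_representatives (G : rel R) X : Prop :=
  forall r, exists! s, s \in X /\ s \in class_of G r.

End FinMonoidTheory.

Section RennerCoxeter.
Variables (R : finMonoidType) (Lam : {set R}) (S : {set units_of R}).
Implicit Types (e f r s : R) (a b w x y : units_of R).

Definition commutant e : {set units_of R} := [set w : units_of R | uval w * e == e * uval w].
Definition fixer e : {set units_of R} :=
  [set w : units_of R | (uval w * e == e * uval w) && (e * uval w == e)].

Definition lam_up e : {set units_of R} :=
  [set s in S | (uval s * e == e * uval s) && (e * uval s != e)].

(* The subsets of S generating commutant e and fixer e when these are standard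
   parabolic subgroups: see gen_lam and gen_lam_low. *)
Definition lam e : {set units_of R} := S :&: commutant e.
Definition lam_low e : {set units_of R} := S :&: fixer e.

Definition transversal_of_idempotents : Prop :=
  Lam \subset idempotents R /\
  {in idempotents R, forall e,
     exists! f, f \in Lam /\ exists w : units_of R, uval w * e * uval (w^-1) = f}.

Record generalized_renner_coxeter : Prop := GeneralizedRennerCoxeter {
  grc_factorizable : factorizable R;
  grc_semilattice : idempotents_meet_semilattice R;
  grc_transversal : transversal_of_idempotents;
  grc_subsemilattice : {in Lam &, forall e f, e * f \in Lam};
  grc_coxeter : coxeter_system S;
  grc_chains : {in idempotents R &, forall e e', idem_le e e' ->
    exists (w : units_of R) (f f' : R),
      [/\ f \in Lam, f' \in Lam, idem_le f f',
          uval w * e * uval (w^-1) = f & uval w * e' * uval (w^-1) = f']};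
  grc_lam_up : {in Lam &, forall e f, idem_le e f -> lam_up e \subset lam_up f};
  grc_parabolic : {in Lam, forall e,
    standard_parabolic S (commutant e) /\ standard_parabolic S (fixer e)}
}.

Lemma gen_parabolic (P : {set units_of R}) :
  standard_parabolic S P -> <<S :&: P>> = P.
Proof.
case=> I IS ->; apply/eqP; rewrite eqEsubset gen_subG subsetIr /=.
by rewrite genS // subsetI IS subset_gen.
Qed.

Lemma gen_lam e : generalized_renner_coxeter -> e \in Lam ->
  <<lam e>> = commutant e.
Proof. by move=> rc /(grc_parabolic rc)[/gen_parabolic]. Qed.

Lemma gen_lam_low e : generalized_renner_coxeter -> e \in Lam ->
  <<lam_low e>> = fixer e.
Proof. by move=> rc /(grc_parabolic rc)[_ /gen_parabolic]. Qed.

Definition left_standard_form r x e y :=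
  [&& r == uval x * e * uval y, e \in Lam, x \in min_lcosets S (lam_low e)
    & y \in min_rcosets S (lam e)].

Definition right_standard_form r y e x :=
  [&& r == uval y * e * uval x, e \in Lam, y \in min_lcosets S (lam e)
    & x \in min_rcosets S (lam_low e)].

Definition adherence_plus : rel R := fun r s =>
  [exists x : units_of R, exists e : R, exists y : units_of R,
   exists a : units_of R, exists f : R, exists b : units_of R,
   [&& left_standard_form r x e y, left_standard_form s a f b, idem_le e f
     & [exists w in <<lam_up f>> * <<lam_low e>>,
          bruhat S x (a * w) && bruhat S (w^-1 * b) y]]].

Definition adherence_minus : rel R := fun r s =>
  [exists y : units_of R, exists e : R, exists x : units_of R,
   exists b : units_of R, exists f : R, exists a : units_of R,
   [&& right_standard_form r y e x, right_standard_form s b f a, idem_le e f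
     & [exists w in <<lam_low e>> * <<lam_up f>>,
          bruhat S x (w * a) && bruhat S (b * w^-1) y]]].

End RennerCoxeter.

Variant sign := Plus | Minus.

Definition opp_sign eps := if eps is Plus then Minus else Plus.

Definition adherence (eps : sign) (R : finMonoidType) (Lam : {set R})
    (S : {set units_of R}) : rel R :=
  if eps is Plus then adherence_plus Lam S else adherence_minus Lam S.

Section Sets.
Variables (R : finMonoidType) (Lam : {set R}) (S : {set units_of R}).
Variable eps : sign.

Definition setGJ : {set R} := mins (adherence eps Lam S) (@greenL R).
Definition setJG : {set R} := mins (adherence eps Lam S) (@greenR R).
Definition setN : {set R} := mins (adherence eps Lam S) (@greenJ R).
Definition setO : {set R} := mins (adherence eps Lam S) (@greenH R).

End Sets.

(* Main.v *)
Require Import Defs.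
From mathcomp Require Import all_boot fingroup perm.

(* Every element of R is x e y with e in Lam, y minimal in W_lam(e) y and x
   determined modulo the fixer of e; the L-class records (e, y), the R-class
   (e, x W_lam(e)), the H-class both, and the J-class e. Two elements with the
   same e are comparable for the order [+] as soon as their outer factors are
   comparable in Bruhat order, so the extremal elements of the classes are read
   off: with x and y minimal modulo W_lam(e) and y_e the longest such y, the
   minima are e y, x e y_e, x e y and e y_e, and the maxima are obtained by
   multiplying with w0. The anti-automorphism r |-> r^* exchanges the two orders
   and the relations L and R, which gives the case [-].
   The set O is closed under restriction of an element to an idempotent, because
   lam^*(g) is contained in lam^*(e) for g <= e, and every product rs is the
   product of the restrictions of r and s to the idempotent r^*r ss^*. Finally GJ
   consists of the r in O with rr^* in Lam, and conjugation by w0 exchanges the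
   sets for [+] and for [-]. *)

Set Implicit Arguments.
Unset Strict Implicit.
Unset Printing Implicit Defensive.

Local Open Scope group_scope.

(** * Coxeter groups: lengths, Bruhat order and parabolic cosets *)

(** The Coxeter hypothesis is a universal property, so the exchange property has to be extracted
    from it: the group is made to act on [gT * bool], and the resulting cocycle tells whether a
    reflection lengthens or shortens an element. The lifting property of Bruhat order and the
    additivity of lengths over parabolic cosets follow, and the antisymmetry of [+] as well as the
    closure arguments rest on them. Right multiplication by w0 reverses left descents, so the
    component of y w0 in W_lam(e), for y minimal, is always the longest element of W_lam(e). This
    explains both the shape of the maxima and why conjugation by w0 respects the forms x e y. The
    delicate point is the closure of GJ under products: the left idempotent of (e y)(f z) is a
    priori only conjugate to an element of Lam. That it lies in Lam is a property of minimal double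
    coset representatives. *)

Lemma gen_indl (gT : finGroupType) (A : {set gT}) (P : gT -> Prop) :
  P 1 -> (forall a w, a \in A -> P w -> P (a * w)) ->
  forall w, w \in <<A>> -> P w.
Proof.
move=> P1 PM w /gen_prodgP[n [c cA ->]].
elim: n c cA => [|n IHn] c cA; first by rewrite big_ord0.
by rewrite big_ord_recl; apply: PM; rewrite ?cA //; apply: IHn => i; apply: cA.
Qed.

Lemma conjgg (gT : groupType) (x : gT) : x ^ x = x.
Proof. by rewrite conjgE mulKg. Qed.

Section CoxeterTheory.
Variables (gT : finGroupType) (S : {set gT}).
Hypothesis cox : coxeter_system S.
Implicit Types (s t u v w x y z : gT) (I J : {set gT}).
Local Notation len := (length S).
Local Notation bru := (bruhat S).
Local Notation T := (reflections S).

Let mem_genS w : w \in <<S>>.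
Proof. by case: cox => -> _ _; rewrite inE. Qed.

Let mulss s : s \in S -> s * s = 1.
Proof. by move=> sS; case: cox => _ /(_ s sS) o2 _; rewrite -expg2 -o2 expg_order. Qed.

Let invs s : s \in S -> s^-1 = s.
Proof. by move=> sS; apply/eqP; rewrite eq_invg_mul mulss. Qed.

(** [length] searches only exponents below [#|gT|], so words must be bounded. The least fixed point
    of [X |-> 1 |: S * X] is reached from the empty set in [#|gT|] steps, and the [k]-th iterate
    holds products of fewer than [k] generators; this lemma and the next give the bound. *)
Lemma expg_set_fix n w : w \in S ^+ n ->
  w \in fixset (fun X : {set gT} => 1 |: S * X).
Proof.
have mono : {homo (fun X : {set gT} => 1 |: S * X) : X Y / X \subset Y}.
  by move=> X Y sXY; rewrite setUS ?mulgS.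
elim: n w => [|n IHn] w; rewrite -(fixsetK mono).
  by rewrite expg0 => /set1P->; rewrite !inE eqxx.
rewrite expgS => /mulsgP[s v sS vS ->]; apply/setUP; right.
by rewrite mem_mulg ?IHn.
Qed.

Lemma fix_expg_set k w :
  w \in iter k (fun X : {set gT} => 1 |: S * X) set0 ->
  exists2 n, n < k & w \in S ^+ n.
Proof.
elim: k w => [|k IHk] w; first by rewrite inE.
rewrite iterS => /setU1P[->|/mulsgP[s v sS /IHk[n ltnk vS] ->]].
  by exists 0; rewrite // expg0 inE.
by exists n.+1; rewrite // expgS mem_mulg.
Qed.

Lemma gen_expg_set w : exists n, w \in S ^+ n.
Proof.
move: w (mem_genS w); apply: gen_indl => [|s w sS [n wS]].
  by exists 0; rewrite expg0 inE.
by exists n.+1; rewrite expgS mem_mulg.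
Qed.

Lemma has_length w : has (fun n => w \in S ^+ n) (iota 0 #|gT|).
Proof.
have [n /expg_set_fix /fix_expg_set[m ltm wS]] := gen_expg_set w.
by apply/hasP; exists m; rewrite ?mem_iota.
Qed.

Lemma mem_length w : w \in S ^+ len w.
Proof.
have := nth_find 0 (has_length w); rewrite nth_iota //.
by have := has_length w; rewrite has_find size_iota.
Qed.

Lemma length_min n w : w \in S ^+ n -> len w <= n.
Proof.
move=> wS; rewrite leqNgt; apply/negP => ltn.
have := before_find 0 ltn; rewrite nth_iota ?add0n ?wS //.
by apply: leq_trans ltn _; rewrite -[#|gT|](size_iota 0) find_size.
Qed.

Lemma length1 : len 1 = 0.
Proof. by apply/eqP; rewrite -leqn0 length_min // expg0 inE. Qed.

Lemma length0 w : len w = 0 -> w = 1.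
Proof. by move=> l0; have := mem_length w; rewrite l0 expg0 => /set1P. Qed.

Lemma lengthS s w : s \in S -> len (s * w) <= (len w).+1.
Proof. by move=> sS; rewrite length_min // expgS mem_mulg ?mem_length. Qed.

Lemma lengthV w : len w^-1 = len w.
Proof.
suff le v : len v^-1 <= len v by apply/eqP; rewrite eqn_leq le -{1}[w]invgK le.
apply: length_min; move: (len v) (mem_length v) => n.
elim: n v => [|n IHn] v; first by rewrite expg0 !inE invg_eq1.
rewrite {1}expgS expgSr => /mulsgP[s u sS uS ->].
by rewrite invMg (invs sS) mem_mulg ?IHn.
Qed.

(** * Reflections: the signed action and the exchange property *)

Definition reflect_flip s (p : gT * bool) : gT * bool :=
  (p.1 ^ s, p.2 (+) (p.1 == s)).

Lemma reflect_flip_inj s : injective (reflect_flip s).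
Proof. by case=> z b [z' b'] [/conjg_inj <- /addIb <-]. Qed.

(** Since [s] inverts [s * t], conjugation by [(s * t) ^+ n] moves the exponent in
    [(s * t) ^+ k * s] by [2n]. *)
Lemma conj_expg_reflection s t n k z : s \in S -> t \in S ->
  (z ^ ((s * t) ^+ n) == (s * t) ^+ k * s) = (z == (s * t) ^+ (n.*2 + k) * s).
Proof.
move=> sS tS; rewrite -(inj_eq (@conjg_inj _ ((s * t) ^- n))) conjgK.
have sp : (s * t) ^+ n * s = s * (s * t) ^- n.
  rewrite conjgC conjXg -expVgn; congr (s * _ ^+ n).
  by rewrite conjgE invMg !invs // !mulgA mulss // mul1g.
rewrite conjgE invgK -!mulgA -sp.
by rewrite -addnn -addnA (addnC n k) !expgD -!mulgA.
Qed.

(** The elements [(s * t) ^+ j * s] with [j < 2n] are the reflections of the alternating word of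
    length [2n] in [s] and [t]; the sign counts how often [z] is hit. *)
Lemma iter_reflect_flip s t n z b : s \in S -> t \in S ->
  iter n (reflect_flip t \o reflect_flip s) (z, b) =
  (z ^ ((s * t) ^+ n),
   b (+) odd (\sum_(0 <= j < n.*2) (z == (s * t) ^+ j * s)%g)).
Proof.
move=> sS tS; elim: n => [|n IHn].
  by rewrite expg0 conjg1 big_geq // addbF.
rewrite iterS IHn /reflect_flip /=; congr pair.
  by rewrite -!conjgM expgSr mulgA.
rewrite doubleS !big_nat_recr //= !oddD !oddb -!addbA; congr (b (+) _).
congr (_ (+) _); congr (_ (+) _).
  by rewrite -[n.*2]addn0 -conj_expg_reflection // expg0 mul1g.
rewrite -addn1 -conj_expg_reflection // expg1.
rewrite -(inj_eq (@conjg_inj _ s)) -conjgM mulss // conjg1.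
by rewrite (conjgE t) (invs sS) mulgA.
Qed.

(** The classical action on signed reflections, extended to all of [gT], satisfies the Coxeter
    relations: for [m = #[s * t]], the [2m] reflections of the alternating word repeat with period
    [m], so every sign changes an even number of times. *)
Lemma expg_reflect_flip s t : s \in S -> t \in S ->
  (perm (@reflect_flip_inj s) * perm (@reflect_flip_inj t)) ^+ #[s * t] = 1.
Proof.
move=> sS tS; apply/permP => -[z b]; rewrite permX perm1.
have -> : iter #[s * t] (perm (@reflect_flip_inj s) * perm (@reflect_flip_inj t))
    (z, b) = iter #[s * t] (reflect_flip t \o reflect_flip s) (z, b).
  by apply: eq_iter => p; rewrite permM !permE.
rewrite iter_reflect_flip // expg_order conjg1 -addnn.
rewrite (big_cat_nat _ (n := #[s * t])) ?leq_addr //=.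
rewrite -{2}[#[s * t]]add0n big_addn addnK.
under [X in (_ + X)%N]eq_bigr => j _ do rewrite expgD expg_order mulg1.
by rewrite addnn odd_double addbF.
Qed.

(* [eta w z] is the parity of the number of times [z] occurs among the
   reflections s_1 .. s_(i-1) s_i s_(i-1) .. s_1 of a word s_1 .. s_k of [w]. *)
Lemma reflection_cocycle : exists eta : gT -> gT -> bool,
  (forall u v z, eta (u * v) z = eta u z (+) eta v (z ^ u)) /\
  {in S, forall s z, eta s z = (z == s)}.
Proof.
have [_ _ univ] := cox.
have [|g gM gS] := univ {perm (gT * bool)} (fun s => perm (@reflect_flip_inj s)).
  by move=> s t sS tS; apply: expg_reflect_flip.
have g1 : g 1 = 1 by apply: (mulgI (g 1)); rewrite -gM !mulg1.
have gE w : forall z b, g w (z, b) = (z ^ w, b (+) (g w (z, false)).2).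
  move: w (mem_genS w); apply: gen_indl => [|s w sS IHw] z b.
    by rewrite g1 !perm1 conjg1 addbF.
  rewrite gM !permM (gS s sS) !permE /reflect_flip /= IHw (IHw _ (z == s)) /=.
  by rewrite conjgM addbA.
exists (fun w z => (g w (z, false)).2); split=> [u v z|s sS z].
  by rewrite gM permM gE gE.
by rewrite gS // permE.
Qed.

Lemma cocycle1 (eta : gT -> gT -> bool) :
  (forall u v z, eta (u * v) z = eta u z (+) eta v (z ^ u)) ->
  forall z, eta 1 z = false.
Proof. by move=> etaM z; have := etaM 1 1 z; rewrite mulg1 conjg1; case: (eta 1 z). Qed.

(** The strong exchange property. An odd count means that [z] occurs among the reflections of a
    reduced word of [w], and deleting the corresponding letter gives a shorter word of [z * w]. If
    the count of [t] in [w] is even, it is odd in [t * w], and the same argument makes [w] the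
    shorter one. *)
Lemma cocycle_lengthP : exists2 eta : gT -> gT -> bool,
  forall u v z, eta (u * v) z = eta u z (+) eta v (z ^ u) &
  {in T, forall t w, eta w t = (len (t * w) < len w)} /\
  {in T, forall t, eta t t}.
Proof.
have [eta [etaM etaS]] := reflection_cocycle; exists eta => //.
have eta1 := cocycle1 etaM.
have etaT : {in T, forall t, eta t t}.
  move=> _ /imset2P[s w sS _ ->].
  (* The outer factors of [w^-1 * s * w] contribute equally, so that only the middle letter
     counts. *)
  have := etaM w^-1 w (s ^ w); rewrite mulVg eta1 conjgK => e0.
  rewrite {1}conjgE !etaM !conjgK conjgg (etaS s sS) eqxx.
  by case: (eta w s) (eta w^-1 _) e0 => [] [].
have lt w z : eta w z -> len (z * w) < len w.
  move: (len w) (mem_length w) => n wS ewz.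
  suff: exists2 m, n = m.+1 & z * w \in S ^+ m.
    by case=> m -> /length_min; rewrite ltnS.
  elim: n w z wS ewz => [|n IHn] w z.
    by rewrite expg0 => /set1P->; rewrite eta1.
  rewrite expgS => /mulsgP[s v sS vS ->]; rewrite etaM (etaS s sS).
  have [-> _|_ /= /(IHn _ _ vS)[m -> zvS]] := eqVneq z s.
    by exists n; rewrite // mulgA mulss // mul1g.
  exists m.+1; rewrite // expgS.
  have -> : z * (s * v) = s * (z ^ s * v) by rewrite conjgE !mulgA mulgV mul1g.
  exact: mem_mulg.
split=> // t tT w; apply/idP/idP; first exact: lt.
apply: contraTT => nlt; rewrite -leqNgt ltnW //.
have tt : t * t = 1.
  case/imset2P: tT => s v sS _ ->.
  by rewrite -conjMg mulss // conj1g.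
have: eta (t * w) t by rewrite etaM conjgg etaT.
by move/lt; rewrite mulgA tt mul1g.
Qed.

(** The cocycle identity for [eta], expressed through lengths alone. *)
Lemma lt_lengthM t u v : t \in T ->
  (len (t * (u * v)) < len (u * v)) =
  (len (t * u) < len u) (+) (len (t ^ u * v) < len v).
Proof.
have [eta etaM [etaL _]] := cocycle_lengthP => tT.
rewrite -!etaL //; case/imset2P: tT => s w sS _ ->.
by rewrite -conjgM; apply: imset2_f; rewrite ?inE.
Qed.

Lemma reflection_inv t : t \in T -> t * t = 1.
Proof. by case/imset2P=> s v sS _ ->; rewrite -conjMg mulss // conj1g. Qed.

Lemma length_reflection t w : t \in T -> (len w < len (t * w)) = ~~ (len (t * w) < len w).
Proof.
have [eta etaM [etaL etaT]] := cocycle_lengthP => tT.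
by rewrite -etaL // -{1}[w]mul1g -(reflection_inv tT) -mulgA -etaL // etaM conjgg etaT.
Qed.

Lemma mem_reflections s : s \in S -> s \in T.
Proof. by move=> sS; rewrite -[s]conjg1 imset2_f ?inE. Qed.

Lemma reflectionsJ t w : t \in T -> t ^ w \in T.
Proof. by case/imset2P=> s v sS _ ->; rewrite -conjgM imset2_f ?inE. Qed.

Lemma length_gen s : s \in S -> len s <= 1.
Proof. by move=> sS; rewrite length_min ?expg1. Qed.

Lemma ltn_length_gen s w : s \in S -> (len w < len (s * w)) = ~~ (len (s * w) < len w).
Proof. by move=> sS; rewrite length_reflection ?mem_reflections. Qed.

(** * Bruhat order and the lifting property *)

Lemma bruhat_refl w : bru w w.
Proof. exact: connect0. Qed.

Lemma bruhat_trans v u w : bru u v -> bru v w -> bru u w.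
Proof. exact: connect_trans. Qed.

(** The order is defined by reflections on the right; since [t * u = u * t ^ u], reflections on the
    left generate the same relation. *)
Lemma bruhat_step t u : t \in T -> len u < len (t * u) -> bru u (t * u).
Proof.
move=> tT lt; apply/connect1/existsP; exists (t ^ u).
by rewrite reflectionsJ // -conjgC eqxx.
Qed.

Lemma bruhat_indl v (P : gT -> Prop) :
  P v ->
  (forall t u, t \in T -> len u < len (t * u) -> bru (t * u) v -> P (t * u) -> P u) ->
  forall u, bru u v -> P u.
Proof.
move=> Pv Pstep u /connectP[p]; elim: p u => [|w p IHp] u /=; first by move=> _ <-.
case/andP=> /existsP[t /and3P[tT /eqP wE lt]] pw vE.
have wE' : w = t ^ u^-1 * u by rewrite wE conjgE invgK mulgA mulgKV.
apply: (Pstep (t ^ u^-1)); rewrite -?wE' ?reflectionsJ //; last exact: IHp.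
by apply/connectP; exists p.
Qed.

Lemma bruhat_eqVlt u v : bru u v -> u = v \/ len u < len v.
Proof.
move: u; apply: bruhat_indl => [|t u _ lt _ [<-|/(ltn_trans lt)]]; by [left|right].
Qed.

Lemma bruhat_length u v : bru u v -> len u <= len v.
Proof. by case/bruhat_eqVlt=> [->|/ltnW]. Qed.

Lemma bruhat_length_eq u v : bru u v -> len v <= len u -> u = v.
Proof. by case/bruhat_eqVlt=> [//|]; rewrite ltnNge => /negbTE->. Qed.

Lemma bruhat_anti u v : bru u v -> bru v u -> u = v.
Proof. by move=> uv /bruhat_length; apply: bruhat_length_eq. Qed.

Lemma bruhat_inv u v : bru u v -> bru u^-1 v^-1.
Proof.
move: u; apply: bruhat_indl => [|t u tT lt _]; first exact: bruhat_refl.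
apply: bruhat_trans; apply/connect1/existsP; exists t.
have /eqP tV : t^-1 == t by rewrite eq_invg_mul reflection_inv.
by rewrite tT !lengthV lt andbT invMg tV eqxx.
Qed.

Lemma bruhatV u v : bru u^-1 v^-1 = bru u v.
Proof. by apply/idP/idP => /bruhat_inv; rewrite ?invgK. Qed.

(** By the cocycle identity, passing from [s * u] to [s * (t * u)] can shorten only if [t ^ s * s]
    is shorter than [s], hence trivial, which means [t = s]. *)
Lemma bruhat_step_gen s t u : s \in S -> t \in T -> len u < len (t * u) ->
  t = s \/ bru (s * u) (s * (t * u)).
Proof.
move=> sS tT lt; have [->|nts] := eqVneq t s; [by left | right].
have ssK : (t ^ s) ^ s = t by rewrite -conjgM mulss // conjg1.
have -> : s * (t * u) = t ^ s * (s * u).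
  by rewrite conjgE (invs sS) -!mulgA (mulgA s s) mulss // mul1g.
apply: bruhat_step; rewrite ?length_reflection ?reflectionsJ //.
rewrite lt_lengthM ?reflectionsJ // ssK ltnNge [X in ~~ (_ (+) X)]ltnNge (ltnW lt) addbF.
rewrite negbK; apply: leq_trans (length_gen sS) _; rewrite lt0n.
apply: contra nts => /eqP/length0 ts1.
by rewrite -ssK -[t ^ s](mulgK s) ts1 mul1g (invs sS) conjgg.
Qed.

(** The lifting property before any assumption on descents. A step along a reflection other than [s]
    survives multiplication by [s]; a step along [s] only exchanges [u] and [s * u]. *)
Lemma bruhat_lift_or s u v : s \in S -> bru u v ->
  (bru (s * u) v \/ bru (s * u) (s * v)) /\ (bru u (s * v) \/ bru (s * u) (s * v)).
Proof.
move=> sS; move: u; apply: bruhat_indl => [|t u tT lt le [IH1 IH2]].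
  by split; right; apply: bruhat_refl.
have uv : bru u v by apply: bruhat_trans le; apply: bruhat_step.
have [tE|su] := bruhat_step_gen sS tT lt.
  have stu : s * (t * u) = u by rewrite tE mulgA mulss ?mul1g.
  rewrite -tE in stu IH1 IH2 *; rewrite stu in IH1 IH2.
  by split; [left | case: IH2; [right|left]].
split.
  by case: IH1 => [IH|IH]; [left|right]; apply: bruhat_trans IH.
case: IH2 => [IH|IH]; [left|right]; apply: bruhat_trans IH => //.
exact: bruhat_step.
Qed.

Lemma bruhat_lift_down s u v : s \in S -> bru u v -> len (s * v) < len v ->
  bru (s * u) v.
Proof.
move=> sS uv lt; have [[//|le] _] := bruhat_lift_or sS uv.
apply: bruhat_trans le _; rewrite -{2}[v](mulKg s) (invs sS).
by apply: bruhat_step; rewrite ?mem_reflections // mulgA mulss ?mul1g.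
Qed.

Lemma bruhat_lift_up s u v : s \in S -> bru u v -> len u < len (s * u) ->
  bru u (s * v).
Proof.
move=> sS uv lt; have [_ [//|le]] := bruhat_lift_or sS uv.
by apply: bruhat_trans le; apply: bruhat_step; rewrite ?mem_reflections.
Qed.

(** By lifting, an element that is raised by all of [I] lies below every element of its coset, and
    here the coset contains 1. *)
Lemma parabolic_left_descent I a : I \subset S -> a \in <<I>> ->
  (forall s, s \in I -> len a < len (s * a)) -> a = 1.
Proof.
move=> sIS aI asc; have: bru a 1.
  rewrite -(mulVg a); move: a^-1 (groupVr aI); apply: gen_indl => [|s w sI].
    by rewrite mul1g bruhat_refl.
  by rewrite -mulgA => /(bruhat_lift_up (subsetP sIS _ sI)) -> //; apply: asc.
by move/bruhat_length_eq; apply; rewrite length1.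
Qed.

(** * Parabolic subgroups and minimal coset representatives *)

Section Parabolic.
Variable I : {set gT}.
Hypothesis sIS : I \subset S.
Local Notation D := (min_rcosets S I).

Let inS s : s \in I -> s \in S. Proof. exact: subsetP. Qed.

Lemma min_rcosetsP w :
  reflect (forall a, a \in <<I>> -> bru w (a * w)) (w \in D).
Proof.
rewrite inE; apply: (iffP forall_inP) => [le a aI|le v].
  by apply: le; rewrite mem_rcoset mulgK.
by rewrite mem_rcoset => /le; rewrite mulgKV.
Qed.

Lemma min_rcosets_ascent w s : w \in D -> s \in I -> len w < len (s * w).
Proof.
move=> /min_rcosetsP le sI; rewrite ltn_length_gen ?inS // -leqNgt.
by apply/bruhat_length/le/mem_gen.
Qed.

Lemma bruhat_min_rcosets y u a : y \in D -> a \in <<I>> -> bru y u -> bru y (a * u).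
Proof.
move=> yD aI yu; move: a aI; apply: gen_indl => [|s a sI]; rewrite ?mul1g //.
by rewrite -mulgA => /(bruhat_lift_up (inS sI)); apply; apply: min_rcosets_ascent.
Qed.

Lemma ascent_min_rcosets w :
  (forall s, s \in I -> len w < len (s * w)) -> w \in D.
Proof.
move=> asc; apply/min_rcosetsP; apply: gen_indl => [|s a sI].
  by rewrite mul1g bruhat_refl.
by rewrite -mulgA => /(bruhat_lift_up (inS sI)); apply; apply: asc.
Qed.

Lemma parabolic_reflection s a : s \in I -> a \in <<I>> -> s ^ a \in <<I>> /\ s ^ a \in T.
Proof.
move=> sI aI; split; first by rewrite groupJ // mem_gen.
by rewrite reflectionsJ ?mem_reflections ?inS.
Qed.

(** Induction on the length of [a]. A left descent [s] of [a] in [I] is also one of [a * y]: by the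
    cocycle identity it could fail to be one only if [s ^ a], an element of the parabolic subgroup,
    shortened the minimal element [y]. *)
Lemma length_min_rcosetsM a y : a \in <<I>> -> y \in D ->
  len (a * y) = (len a + len y)%N.
Proof.
move=> aI yD; move: {2}(len a) (leqnn (len a)) => n.
elim: n a aI => [|n IHn] a aI.
  by rewrite leqn0 => /eqP/length0->; rewrite mul1g length1.
have [-> _|na1 lea] := eqVneq a 1; first by rewrite mul1g length1.
have [s sI lt] : exists2 s, s \in I & len (s * a) < len a.
  apply/exists_inP; apply: contraNT na1 => /exists_inPn asc; apply/eqP.
  by apply: (parabolic_left_descent sIS aI) => s sI; rewrite ltn_length_gen ?inS ?asc.
have [saI tT] : s * a \in <<I>> /\ s ^ a \in T.
  by split; [rewrite groupM // mem_gen | case: (parabolic_reflection sI aI)].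
have sT : s \in T by rewrite mem_reflections ?inS.
have lt' : len (s * (a * y)) < len (a * y).
  have [saI' _] := parabolic_reflection sI aI.
  by rewrite lt_lengthM // lt ltnNge (bruhat_length (min_rcosetsP _ yD _ saI')).
have eS u : len (s * u) < len u -> len u = (len (s * u)).+1.
  move=> ltu; apply/eqP; rewrite eqn_leq ltu andbT.
  by rewrite -{1}[u]mul1g -(mulss (inS sI)) -mulgA lengthS ?inS.
rewrite (eS _ lt') (eS _ lt) mulgA IHn //.
by rewrite -ltnS (leq_trans lt).
Qed.

(** A shortest element of the coset has no left descent in [I], and lifting turns this into Bruhat
    minimality. *)
Lemma min_rcosets_decomposition w : exists a y, [/\ a \in <<I>>, y \in D & w = a * y].
Proof.
have w1 : w \in <<I>> :* w by apply: rcoset_refl.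
pose y := [arg min_(v < w in <<I>> :* w) len v].
have [yw ymin] : y \in <<I>> :* w /\ {in <<I>> :* w, forall v, len y <= len v}.
  by rewrite /y; case: arg_minnP => // y0 ? ?; split.
have aI : w * y^-1 \in <<I>>.
  by rewrite -[w * _]invgK groupV invMg invgK -mem_rcoset.
exists (w * y^-1), y; split=> //; last by rewrite mulgKV.
apply: ascent_min_rcosets => s sI; rewrite ltn_length_gen ?inS // -leqNgt ymin //.
by move: yw; rewrite !mem_rcoset -mulgA => yw; rewrite groupM // mem_gen.
Qed.

Lemma min_rcosets_inj a y a' y' : a \in <<I>> -> a' \in <<I>> -> y \in D -> y' \in D ->
  a * y = a' * y' -> a = a' /\ y = y'.
Proof.
move=> aI a'I yD y'D eq; suff yy' : y = y'.
  by split=> //; apply: (mulIg y); rewrite eq yy'.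
apply: bruhat_anti.
  have -> : y' = a'^-1 * a * y by rewrite -mulgA eq mulKg.
  by apply: (min_rcosetsP _ yD); rewrite groupM ?groupV.
have -> : y = a^-1 * a' * y' by rewrite -mulgA -eq mulKg.
by apply: (min_rcosetsP _ y'D); rewrite groupM ?groupV.
Qed.

Lemma bruhat_parabolic_top b v a :
  (forall s, s \in I -> len (s * b) < len b) -> bru v b -> a \in <<I>> -> bru (a * v) b.
Proof.
move=> desc vb; move: a; apply: gen_indl => [|s a sI]; rewrite ?mul1g //.
by rewrite -mulgA => /(bruhat_lift_down (inS sI)); apply; apply: desc.
Qed.

(** When a first letter [s] of [p] is removed, lifting leaves [y] or [s * y] below the rest, and [s]
    does not affect membership. *)
Lemma bruhat_parabolic y p : bru y p -> p \in <<I>> -> y \in <<I>>.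
Proof.
move=> yp pI; move: p pI y yp; apply: gen_indl => [|s p sI IHp] y.
  by move/bruhat_length_eq=> ->; rewrite ?group1 // length1.
move=> ysp; have sS := inS sI.
have [_ [le|le]] := bruhat_lift_or sS ysp; move: le; rewrite mulgA mulss // mul1g => /IHp //.
by rewrite (groupMl _ (mem_gen sI)).
Qed.

End Parabolic.

Lemma min_rcosetsS I J : I \subset J ->
  min_rcosets S J \subset min_rcosets S I.
Proof.
move=> IJ; apply/subsetP => w /min_rcosetsP le.
by apply/min_rcosetsP => a aI; apply/le/(subsetP (genS IJ)).
Qed.

Lemma min_lcosets_inv I w : (w \in min_lcosets S I) = (w^-1 \in min_rcosets S I).
Proof.
rewrite !inE; apply/forall_inP/forall_inP => le v.
  rewrite mem_rcoset invgK => vI; rewrite -bruhatV invgK le // mem_lcoset.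
  by rewrite -groupV invMg !invgK.
rewrite mem_lcoset => vI; rewrite -bruhatV le // mem_rcoset invgK.
by rewrite -groupV invMg !invgK.
Qed.

Lemma mem_min_lcosetsV I w : (w^-1 \in min_lcosets S I) = (w \in min_rcosets S I).
Proof. by rewrite min_lcosets_inv invgK. Qed.

Lemma bruhat_min_lcosets I x u a : I \subset S ->
  x \in min_lcosets S I -> a \in <<I>> -> bru x u -> bru x (u * a).
Proof.
move=> IS; rewrite min_lcosets_inv -bruhatV -[bru x (u * a)]bruhatV invMg => xD aI xu.
by apply: (bruhat_min_rcosets IS); rewrite ?groupV.
Qed.

Lemma min_lcosets_decomposition I w : I \subset S ->
  exists x a, [/\ x \in min_lcosets S I, a \in <<I>> & w = x * a].
Proof.
move=> IS; have [a [x [aI xD wE]]] := min_rcosets_decomposition IS w^-1.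
exists x^-1, a^-1; split; rewrite ?mem_min_lcosetsV ?groupV //.
by rewrite -invMg -wE invgK.
Qed.

Lemma min_lcosets_inj I x x' : x \in min_lcosets S I -> x' \in min_lcosets S I ->
  x^-1 * x' \in <<I>> -> x = x'.
Proof.
rewrite !min_lcosets_inv => xD x'D xx'; apply: invg_inj.
have [] := min_rcosets_inj (group1 _) xx' xD x'D => //.
by rewrite mul1g mulgK.
Qed.

Lemma bruhat1 w : bru 1 w.
Proof.
move: w (mem_genS w); apply: gen_indl => [|s w sS /(bruhat_lift_up sS)]; first exact: bruhat_refl.
by apply; rewrite mulg1 length1 lt0n; apply/eqP => /length0 s1; case: cox => _ /(_ s sS);
   rewrite s1 order1.
Qed.

Lemma min_rcosets1 I : 1 \in min_rcosets S I.
Proof.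
apply/min_rcosetsP => a aI; rewrite mulg1.
exact: bruhat1.
Qed.

Lemma length_le_mul u v : len (u * v) <= len u + len v.
Proof. by rewrite length_min // expgD mem_mulg ?mem_length. Qed.

(** A generator that does not raise [y] cannot raise [y * b] either, by subadditivity of the
    length. *)
Lemma min_rcosets_prefix I y b : I \subset S ->
  y * b \in min_rcosets S I -> len (y * b) = (len y + len b)%N -> y \in min_rcosets S I.
Proof.
move=> IS ybD lenE; apply: (ascent_min_rcosets IS) => s sI.
have := min_rcosets_ascent IS ybD sI; rewrite lenE mulgA => lt.
rewrite -(ltn_add2r (len b)); exact: leq_trans lt (length_le_mul _ _).
Qed.

Lemma length_min_lcosetsM I x a : I \subset S -> x \in min_lcosets S I -> a \in <<I>> ->
  len (x * a) = (len x + len a)%N.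
Proof.
move=> IS; rewrite min_lcosets_inv -lengthV invMg => xD aI.
by rewrite (length_min_rcosetsM IS) ?groupV // !lengthV addnC.
Qed.

Lemma bruhat_parabolic_topM I b y u : I \subset S -> y \in min_rcosets S I ->
  b \in <<I>> -> {in <<I>>, forall v, bru v b} -> u \in <<I>> -> bru (u * y) (b * y).
Proof.
move=> IS yD bI top uI; apply: (bruhat_parabolic_top IS _ _ uI).
  move=> s sI; have sbI : s * b \in <<I>> by rewrite groupM // mem_gen.
  rewrite mulgA !(length_min_rcosetsM IS _ yD) // ltn_add2r ltnNge.
  have sS := subsetP IS s sI; rewrite leqNgt negbK.
  by rewrite -[_ < _]negbK -ltn_length_gen // -leqNgt bruhat_length // top.
by apply: (bruhat_min_rcosets IS) => //; apply: bruhat_refl.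
Qed.

(** * The longest element *)

Section Longest.
Variable w0 : gT.
Hypothesis w0P : longest S w0.

Lemma length_reflection_longest t : t \in T -> len (t * w0) < len w0.
Proof.
by move=> tT; have := w0P (t * w0); rewrite leqNgt length_reflection // negbK.
Qed.

Lemma bruhat_longest v : bru v w0.
Proof.
rewrite -[v]mulg1; apply: (bruhat_parabolic_top (subxx S) _ _ (mem_genS v)).
  by move=> s sS; rewrite length_reflection_longest ?mem_reflections.
rewrite -(mulVg w0); apply: (bruhat_parabolic_top (subxx S) _ _ (mem_genS _)).
  by move=> s sS; rewrite length_reflection_longest ?mem_reflections.
exact: bruhat_refl.
Qed.

Lemma longest_involution : w0 * w0 = 1.
Proof.
have w0V : w0^-1 = w0.
  by apply: bruhat_length_eq; rewrite ?bruhat_longest // lengthV.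
by rewrite -{1}w0V mulVg.
Qed.

(** No [s] in [I] is a left descent of [y], and right multiplication by [w0] reverses descents, so
    all of [I] are descents of [b * y']. Additivity of lengths passes them on to [b], and an element
    of the parabolic subgroup with all these descents is its greatest element. *)
Lemma longest_parabolic_component I y b y' : I \subset S ->
  y \in min_rcosets S I -> b \in <<I>> -> y' \in min_rcosets S I -> y * w0 = b * y' ->
  {in <<I>>, forall u, bru u b}.
Proof.
move=> IS yD bI y'D eq u uI; rewrite -[u]mulg1.
have desc s : s \in I -> len (s * b) < len b.
  move=> sI; have sS := subsetP IS s sI; have sT := mem_reflections sS.
  have: len (s * (y * w0)) < len (y * w0).
    rewrite lt_lengthM // length_reflection_longest ?reflectionsJ // addbT.
    by rewrite -ltn_length_gen // (min_rcosets_ascent IS).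
  have sbI : s * b \in <<I>> by rewrite groupM // mem_gen.
  by rewrite eq mulgA !(length_min_rcosetsM IS _ y'D) // ltn_add2r.
apply: (bruhat_parabolic_top IS desc _ uI).
by rewrite -(mulVg b); apply: (bruhat_parabolic_top IS desc); rewrite ?groupV ?bruhat_refl.
Qed.

End Longest.

Lemma bruhat_min_lcosets_top I x x' b : I \subset S -> x \in min_lcosets S I ->
  b \in <<I>> -> {in <<I>>, forall v, bru v b} -> x^-1 * x' \in <<I>> -> bru x' (x * b).
Proof.
move=> IS; rewrite min_lcosets_inv => xD bI top xx'.
(* The inverse of [b] lies below [b] and has the same length. *)
have bV : b^-1 = b by apply: bruhat_length_eq; rewrite ?lengthV ?top ?groupV.
rewrite -bruhatV invMg bV -[x'^-1](mulgK x).
by apply: (bruhat_parabolic_topM IS); rewrite // -groupV invMg invgK.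
Qed.

End CoxeterTheory.

(** * Finite factorizable inverse monoids *)

Section InverseMonoid.
Variable R : finMonoidType.
Hypothesis fac : factorizable R.
Hypothesis semi : idempotents_meet_semilattice R.
Implicit Types (e f g h k r s t : R) (w : units_of R).

Lemma uval1 : uval 1 = 1 :> R. Proof. by []. Qed.

Lemma uvalM v w : uval (v * w) = uval v * uval w. Proof. by []. Qed.

Lemma uvalVM w r : uval w^-1 * (uval w * r) = r.
Proof. by rewrite mulgA -[_ * uval w]/(uval (w^-1 * w)) mulVg mul1g. Qed.

Lemma uvalMV w r : uval w * (uval w^-1 * r) = r.
Proof. by rewrite -{1}[w]invgK uvalVM. Qed.

Lemma uvalMK w r : r * uval w * uval w^-1 = r.
Proof. by rewrite -mulgA -[uval w * _]/(uval (w * w^-1)) mulgV mulg1. Qed.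

Lemma uvalMVK w r : r * uval w^-1 * uval w = r.
Proof. by rewrite -{2}[w]invgK uvalMK. Qed.

Lemma idempotentE e : e \in idempotents R -> e * e = e.
Proof. by rewrite inE => /eqP. Qed.

Lemma idempotentMK e z : e \in idempotents R -> e * (e * z) = e * z.
Proof. by move=> eE; rewrite mulgA idempotentE. Qed.

Lemma idempotentM e f : e \in idempotents R -> f \in idempotents R -> e * f \in idempotents R.
Proof. by move=> eE fE; case: (semi eE fE). Qed.

(** Both products are meets of the same two idempotents, and a meet is unique. *)
Lemma idempotentC e f : e \in idempotents R -> f \in idempotents R -> e * f = f * e.
Proof.
move=> eE fE; have [efE efe eff max1] := semi eE fE; have [feE fef fee max2] := semi fE eE.
by case/andP: (max1 _ feE fee fef) => _ /eqP <-; case/andP: (max2 _ efE eff efe) => /eqP.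
Qed.

Lemma weak_inverseP r s : reflect (r * s * r = r /\ s * r * s = s) (weak_inverse r s).
Proof. by apply: (iffP andP) => -[/eqP ? /eqP]. Qed.

Lemma weak_inverse_sym r s : weak_inverse r s -> weak_inverse s r.
Proof. by rewrite /weak_inverse andbC. Qed.

Lemma weak_inverse_idem r s : weak_inverse r s -> r * s \in idempotents R.
Proof. by case/weak_inverseP=> rsr _; rewrite inE mulgA rsr. Qed.

Lemma weak_inverse_uniq r s t : weak_inverse r s -> weak_inverse r t -> s = t.
Proof.
move=> rs rt; have rsE := weak_inverse_idem rs; have rtE := weak_inverse_idem rt.
have srE := weak_inverse_idem (weak_inverse_sym rs).
have trE := weak_inverse_idem (weak_inverse_sym rt).
case/weak_inverseP: rs => rsr srs; case/weak_inverseP: rt => rtr trt.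
have rs_rt : r * s = r * t.
  by rewrite -{1}rtr -(mulgA (r * t)) (idempotentC rtE rsE) mulgA rsr.
have sr_tr : s * r = t * r.
  by rewrite -{1}rtr -(mulgA r) (mulgA s) (idempotentC srE trE) -(mulgA t) (mulgA r) rsr.
by rewrite -srs sr_tr -mulgA rs_rt mulgA.
Qed.

Lemma idempotent1 : 1 \in idempotents R.
Proof. by rewrite inE mulg1. Qed.

Lemma idempotent_conj w e : e \in idempotents R ->
  uval w * e * uval w^-1 \in idempotents R.
Proof. by move=> eE; rewrite inE -!mulgA uvalVM idempotentMK. Qed.

Lemma weak_inverse_form x e y : e \in idempotents R ->
  weak_inverse (uval x * e * uval y) (uval y^-1 * e * uval x^-1).
Proof.
by move=> eE; apply/weak_inverseP; rewrite -!mulgA !(uvalMV, uvalVM) !idempotentMK.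
Qed.

Lemma exists_weak_inverse r : exists s, weak_inverse r s.
Proof.
have [[e [w [eE ->]]] _] := fac r; exists (uval w^-1 * e).
by have := weak_inverse_form 1 w eE; rewrite invg1 uval1 mul1g mulg1.
Qed.

Lemma star_weak_inverse r : weak_inverse r (star r).
Proof.
rewrite /star; case: pickP => [//|no]; have [s] := exists_weak_inverse r.
by rewrite no.
Qed.

Lemma star_eq r s : weak_inverse r s -> star r = s.
Proof. by apply: weak_inverse_uniq; apply: star_weak_inverse. Qed.

Lemma mul_star_mul r : r * star r * r = r.
Proof. by case/weak_inverseP: (star_weak_inverse r). Qed.

Lemma star_mul_star r : star r * r * star r = star r.
Proof. by case/weak_inverseP: (star_weak_inverse r). Qed.

Lemma starK : involutive (@star R).
Proof. by move=> r; apply/star_eq/weak_inverse_sym/star_weak_inverse. Qed.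

Lemma idempotent_mul_star r : r * star r \in idempotents R.
Proof. exact/weak_inverse_idem/star_weak_inverse. Qed.

Lemma idempotent_star_mul r : star r * r \in idempotents R.
Proof. exact/weak_inverse_idem/weak_inverse_sym/star_weak_inverse. Qed.

Lemma starM r s : star (r * s) = star s * star r.
Proof.
have C := idempotentC (idempotent_star_mul r) (idempotent_mul_star s).
apply/star_eq/weak_inverseP; split.
  rewrite -!mulgA (mulgA s) (mulgA (star r)) (mulgA (s * _)) -C.
  by rewrite -!mulgA (mulgA s) mul_star_mul !mulgA mul_star_mul.
rewrite -!mulgA (mulgA s) (mulgA (star r) r) (mulgA (star r * r)) C.
by rewrite -!mulgA (mulgA (star r) r) star_mul_star !mulgA star_mul_star.
Qed.

Lemma star_idempotent e : e \in idempotents R -> star e = e.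
Proof. by move=> eE; apply/star_eq/weak_inverseP; rewrite !idempotentE. Qed.

Lemma star_form x e y : e \in idempotents R ->
  star (uval x * e * uval y) = uval y^-1 * e * uval x^-1.
Proof. by move=> eE; apply/star_eq/weak_inverse_form. Qed.

Lemma star_unit w : star (uval w) = uval w^-1.
Proof. by have := star_form w 1 idempotent1; rewrite invg1 uval1 !mulg1 mul1g. Qed.

Lemma greenL_star_mul r s : greenL r s = (star r * r == star s * s).
Proof.
apply/eqP/eqP => [eq|].
  have /imsetP[u _ rE] : r \in [set u * s | u : R].
    by rewrite -eq; apply/imsetP; exists 1; rewrite ?mul1g.
  have /imsetP[v _ sE] : s \in [set v * r | v : R].
    by rewrite eq; apply/imsetP; exists 1; rewrite ?mul1g.
  have rs : r * (star s * s) = r by rewrite {1}rE -mulgA (mulgA s) mul_star_mul.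
  have sr : s * (star r * r) = s by rewrite {1}sE -mulgA (mulgA r) mul_star_mul.
  transitivity (star r * r * (star s * s)); first by rewrite -(mulgA (star r)) rs.
  by rewrite idempotentC ?idempotent_star_mul // -(mulgA (star s)) sr.
suff sub r' s' : star r' * r' = star s' * s' ->
    [set u * r' | u : R] \subset [set u * s' | u : R].
  by move=> eq; apply/eqP; rewrite eqEsubset !sub.
move=> eq; apply/subsetP => _ /imsetP[u _ ->]; apply/imsetP.
by exists (u * r' * star s'); rewrite // -(mulgA _ (star s')) -eq -mulgA (mulgA r') mul_star_mul.
Qed.

Lemma greenR_mul_star r s : greenR r s = (r * star r == s * star s).
Proof.
apply/eqP/eqP => [eq|].
  have /imsetP[u _ rE] : r \in [set s * u | u : R].
    by rewrite -eq; apply/imsetP; exists 1; rewrite ?mulg1.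
  have /imsetP[v _ sE] : s \in [set r * v | v : R].
    by rewrite eq; apply/imsetP; exists 1; rewrite ?mulg1.
  have rs : s * star s * r = r by rewrite {1}rE mulgA mul_star_mul.
  have sr : r * star r * s = s by rewrite {1}sE mulgA mul_star_mul.
  transitivity (s * star s * (r * star r)); first by rewrite (mulgA _ r) rs.
  by rewrite idempotentC ?idempotent_mul_star // (mulgA _ s) sr.
suff sub r' s' : r' * star r' = s' * star s' ->
    [set r' * u | u : R] \subset [set s' * u | u : R].
  by move=> eq; apply/eqP; rewrite eqEsubset !sub.
move=> eq; apply/subsetP => _ /imsetP[u _ ->]; apply/imsetP.
by exists (star s' * (r' * u)); rewrite // mulgA -eq mulgA mul_star_mul.
Qed.

Lemma greenR_star r s : greenR r s = greenL (star r) (star s).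
Proof. by rewrite greenR_mul_star greenL_star_mul !starK. Qed.

Lemma greenL_star r s : greenL r s = greenR (star r) (star s).
Proof. by rewrite greenR_star !starK. Qed.

Lemma greenH_star r s : greenH r s = greenH (star r) (star s).
Proof. by rewrite /greenH -greenL_star -greenR_star andbC. Qed.

Lemma greenJP r s :
  reflect ((exists u v, r = u * s * v) /\ (exists u v, s = u * r * v)) (greenJ r s).
Proof.
apply: (iffP eqP) => [eq|].
  have mem t : t \in [set u * t * v | u : R, v : R].
    by apply/imset2P; exists 1 1; rewrite // mul1g mulg1.
  split; [move: (mem r) | move: (mem s)]; rewrite (eq, esym eq) => /imset2P[u v _ _ E];
    by exists u, v.
have sub r' s' u v : r' = u * s' * v ->
    [set a * r' * b | a : R, b : R] \subset [set a * s' * b | a : R, b : R].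
  move=> ->; apply/subsetP => _ /imset2P[a b _ _ ->].
  have -> : a * (u * s' * v) * b = (a * u) * s' * (v * b) by rewrite !mulgA.
  by apply/imset2P; apply: Imset2spec.
by case=> [[u [v rE]] [u' [v' sE]]]; apply/eqP; rewrite eqEsubset (sub _ _ _ _ rE) (sub _ _ _ _ sE).
Qed.

Lemma greenJ_star r s : greenJ r s = greenJ (star r) (star s).
Proof.
suff sub r' s' : greenJ r' s' -> greenJ (star r') (star s').
  by apply/idP/idP => [/sub|/sub]; rewrite ?starK.
case/greenJP=> [[u [v rE]] [u' [v' sE]]]; apply/greenJP; split.
  by exists (star v), (star u); rewrite rE !starM mulgA.
by exists (star v'), (star u'); rewrite sE !starM mulgA.
Qed.

(** The size of the right ideal of [r] replaces the rank of a matrix: it does not grow under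
    multiplication on either side, and it strictly decreases when an idempotent is replaced by a
    smaller one. *)
Definition rank r := #|[set r * u | u : R]|.

Lemma rank_mul a r b : rank (a * r * b) <= rank r.
Proof.
apply: leq_trans (leq_imset_card (fun t => a * t) [set r * u | u : R]).
apply/subset_leq_card/subsetP => _ /imsetP[u _ ->]; apply/imsetP.
by exists (r * (b * u)); rewrite ?mulgA //; apply/imsetP; exists (b * u); rewrite ?mulgA.
Qed.

Lemma idempotent_rank_eq k e : k \in idempotents R -> e \in idempotents R ->
  e * k = k -> rank e <= rank k -> k = e.
Proof.
move=> kE eE ekk le.
have sub : [set k * u | u : R] \subset [set e * u | u : R].
  by apply/subsetP => _ /imsetP[u _ ->]; apply/imsetP; exists (k * u); rewrite // mulgA ekk.
have eq : [set k * u | u : R] == [set e * u | u : R] by rewrite eqEcard sub.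
have /imsetP[u _ eE'] : e \in [set k * u | u : R].
  by rewrite (eqP eq); apply/imsetP; exists 1; rewrite ?mulg1.
by rewrite -[LHS]ekk idempotentC // {1}eE' idempotentMK.
Qed.

(* An equation [e = p e' q] can be refined to [e = w e' w'] with units w, w',
   as cutting e' down by the idempotent parts of p and q would drop its rank. *)
Lemma greenJ_idempotent e e' : e \in idempotents R -> e' \in idempotents R ->
  greenJ e e' -> exists w, uval w * e' * uval w^-1 = e.
Proof.
move=> eE e'E /greenJP[[p [q eq]] [p' [q' eq']]].
have rk : rank e' <= rank e by rewrite eq' rank_mul.
have [_ [h [w [hE pE]]]] := fac p; have [[h' [w' [h'E qE]]] _] := fac q.
have he' : h * e' = e'.
  apply: idempotent_rank_eq; rewrite ?idempotentM //.
    by rewrite mulgA (idempotentC e'E) // -mulgA idempotentE.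
  apply: leq_trans rk _; rewrite eq pE -(mulgA (uval w)); exact: rank_mul.
have e'h' : e' * h' = e'.
  apply: idempotent_rank_eq; rewrite ?idempotentM ?idempotentMK //.
  by apply: leq_trans rk _; rewrite eq qE mulgA -(mulgA p); apply: rank_mul.
have eww : e = uval w * e' * uval w'.
  by rewrite eq pE qE -(mulgA _ h) he' -!mulgA (mulgA e') e'h'.
exists w; have <- : e * star e = uval w * e' * uval w^-1.
  by rewrite eww star_form // -!mulgA uvalMV idempotentMK.
by rewrite star_idempotent ?idempotentE.
Qed.

Lemma mem_star_image (X : {set R}) r : (r \in [set star s | s in X]) = (star r \in X).
Proof.
apply/imsetP/idP => [[s sX ->]|rX]; first by rewrite starK.
by exists (star r); rewrite ?starK.
Qed.

End InverseMonoid.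

(** * Extremal elements read off from explicit representatives *)

Section Extrema.
Variables (R : finMonoidType) (le G : rel R) (P : R -> Prop).
Hypothesis anti : forall r s, le r s -> le s r -> r = s.
Hypothesis symG : symmetric G.
Hypothesis transG : transitive G.
Hypothesis exP : forall r, exists2 m, P m & G r m.

(** Antisymmetry identifies a minimum of a class with the element of [P] in that class, so each
    Green relation reduces to producing one such element and comparing it with its class. *)
Lemma minsP : (forall m t, P m -> G m t -> le m t) -> forall r, r \in mins le G <-> P r.
Proof.
move=> minP r; split=> [|Pr].
  rewrite inE => /forall_inP rmin; have [m Pm rm] := exP r.
  by rewrite (anti (rmin m _) (minP m r Pm _)) // ?inE // symG.
by rewrite inE; apply/forall_inP => t; rewrite inE; apply: minP.
Qed.

Lemma maxsP : (forall m t, P m -> G m t -> le t m) -> forall r, r \in maxs le G <-> P r.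
Proof.
move=> maxP r; split=> [|Pr].
  rewrite inE => /forall_inP rmax; have [m Pm rm] := exP r.
  by rewrite (anti (maxP m r Pm _) (rmax m _)) // ?inE // symG.
by rewrite inE; apply/forall_inP => t; rewrite inE; apply: maxP.
Qed.

Lemma class_representatives_mins :
  (forall m t, P m -> G m t -> le m t) -> class_representatives G (mins le G).
Proof.
move=> minP r; have [m Pm rm] := exP r; exists m; split.
  by split; [apply/(minsP minP) | rewrite inE].
move=> m' [/(minsP minP) Pm']; rewrite inE => rm'.
by apply: anti; apply: minP => //; apply: transG (_ : G _ r) _; rewrite // symG.
Qed.

End Extrema.

(** * Renner-Coxeter systems *)

Section RennerCoxeter.
Variables (R : finMonoidType) (Lam : {set R}) (S : {set units_of R}) (w0 : units_of R).
Hypothesis rc : generalized_renner_coxeter Lam S.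
Hypothesis w0P : longest S w0.
Implicit Types (e f g h k r s t : R) (a b c u v w x y z : units_of R).
Local Notation len := (length S).
Local Notation bru := (bruhat S).
Local Notation LL e := (min_lcosets S (lam S e)).
Local Notation LR e := (min_rcosets S (lam S e)).
Local Notation le := (adherence_plus Lam S).

Let cox : coxeter_system S := grc_coxeter rc.
Let fac : factorizable R := grc_factorizable rc.
Let semi : idempotents_meet_semilattice R := grc_semilattice rc.

Lemma lamS e : lam S e \subset S. Proof. exact: subsetIl. Qed.
Lemma lam_lowS e : lam_low S e \subset S. Proof. exact: subsetIl. Qed.
Lemma lam_upS e : lam_up S e \subset S.
Proof. by apply/subsetP => s; rewrite inE => /andP[]. Qed.
Hint Resolve lamS lam_lowS lam_upS : core.

Lemma Lam_idempotent e : e \in Lam -> e \in idempotents R.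
Proof. by case: (grc_transversal rc) => /subsetP + _; apply. Qed.
Hint Resolve Lam_idempotent : core.

Lemma Lam_conj e f w : e \in Lam -> f \in Lam -> uval w * e * uval w^-1 = f -> e = f.
Proof.
move=> eL fL ef; case: (grc_transversal rc) => _ /(_ e (Lam_idempotent eL))[f' [_ uniq]].
rewrite -(uniq f); last by split=> //; exists w.
by apply/esym/uniq; split=> //; exists 1; rewrite invg1 uval1 mul1g mulg1.
Qed.

Lemma Lam1 : 1 \in Lam.
Proof.
case: (grc_transversal rc) => _ /(_ 1 (idempotent1 R))[f [[fL [w fE]] _]].
by suff -> : 1 = f by []; rewrite -fE -(mul1g (_ * 1)) mulg1 uvalMK.
Qed.

(** * Commutants and fixers as parabolic subgroups *)

Lemma commutantE e w : w \in commutant e -> uval w * e = e * uval w.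
Proof. by rewrite inE => /eqP. Qed.

Lemma mem_fixer e w : (w \in fixer e) = (w \in commutant e) && (e * uval w == e).
Proof. by rewrite !inE. Qed.

Lemma fixer_commutant e w : w \in fixer e -> w \in commutant e.
Proof. by rewrite !inE => /andP[]. Qed.

Lemma fixerE e w : w \in fixer e -> e * uval w = e.
Proof. by rewrite inE => /andP[_ /eqP]. Qed.

Lemma fixerEl e w : w \in fixer e -> uval w * e = e.
Proof. by move=> wF; rewrite (commutantE (fixer_commutant wF)) fixerE. Qed.

Lemma commutant_conj e w : (w \in commutant e) <-> (uval w * e * uval w^-1 = e).
Proof.
rewrite inE; split=> [/eqP->|eq]; first by rewrite uvalMK.
by apply/eqP; rewrite -{2}eq uvalMVK.
Qed.

Lemma mem_lam e w : e \in Lam -> (w \in <<lam S e>>) = (w \in commutant e).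
Proof. by move=> eL; rewrite (gen_lam rc eL). Qed.

Lemma mem_lam_low e w : e \in Lam -> (w \in <<lam_low S e>>) = (w \in fixer e).
Proof. by move=> eL; rewrite (gen_lam_low rc eL). Qed.

Lemma lam_lowU e : lam S e = lam_up S e :|: lam_low S e.
Proof.
apply/setP => s; rewrite !inE; case: (s \in S) => //=.
by case: (_ * e == _) => //=; rewrite orNb.
Qed.

Lemma lam_low_sub e : lam_low S e \subset lam S e.
Proof. by rewrite lam_lowU subsetUr. Qed.

Lemma lam_up_sub e : lam_up S e \subset lam S e.
Proof. by rewrite lam_lowU subsetUl. Qed.

(** [lam] is the union of [lam_up] and [lam_low], and units commuting with [e] normalize its fixer;
    the join of the two subgroups is therefore their product. *)
Lemma gen_lamM e : e \in Lam -> <<lam S e>> = <<lam_up S e>> * <<lam_low S e>>.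
Proof.
move=> eL; rewrite lam_lowU -joingE -joing_idl -joing_idr norm_joinEl //.
rewrite gen_subG; apply/subsetP => s sU; rewrite inE; apply/subsetP => _ /imsetP[v vF ->].
rewrite !mem_lam_low // in vF *.
have sC : s \in commutant e by rewrite -mem_lam // mem_gen // (subsetP (lam_up_sub e)).
have svC : v ^ s \in commutant e.
  by rewrite -mem_lam // groupJ // mem_lam // fixer_commutant.
rewrite mem_fixer svC conjgE !uvalM andTb.
have sVC : s^-1 \in commutant e by rewrite -mem_lam // groupV mem_lam.
apply/eqP; rewrite -[RHS](uvalMVK s) -(commutantE sVC) -[in RHS](fixerE vF).
by rewrite mulgA -(commutantE sVC) -!mulgA.
Qed.

(** A descent [s] of [q] satisfies [s <= q] in Bruhat order, hence lies in the parabolic subgroup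
    fixing [e], whereas elements of [lam_up] do not fix [e]. *)
Lemma fixer_min_rcosets_up e q : e \in Lam -> q \in fixer e -> q \in min_rcosets S (lam_up S e).
Proof.
move=> eL qF; apply: (ascent_min_rcosets cox (lam_upS e)) => s sU.
have sS := subsetP (lam_upS e) s sU; rewrite ltn_length_gen //; apply/negP => lt.
have: s \in <<lam_low S e>>.
  apply: (bruhat_parabolic cox (lam_lowS e) _ (p := q)); last by rewrite mem_lam_low.
  by rewrite -[s]mulg1; apply: bruhat_lift_down => //; apply: bruhat1.
by rewrite mem_lam_low // => /fixerE sF; move: sU; rewrite inE sF eqxx !andbF.
Qed.

(** Write [y = p q z] with [p] from [lam_up], [q] from [lam_low] and [z] in [LR e]. Lengths add up,
    so a descent of [p] in [lam_up] would be one of [y]; thus [p = 1]. *)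
Lemma min_rcosets_up e y : e \in Lam -> y \in min_rcosets S (lam_up S e) ->
  exists b z, [/\ b \in fixer e, z \in LR e & y = b * z].
Proof.
move=> eL yD; have [c [z [cW zD yE]]] := min_rcosets_decomposition cox (lamS e) y.
move: (cW); rewrite gen_lamM // => /mulsgP[p q pU qF cE].
suff p1 : p = 1 by exists q, z; rewrite -mem_lam_low // yE cE p1 mul1g.
apply: (parabolic_left_descent cox (lam_upS e) pU) => s sU.
have := min_rcosets_ascent cox (lam_upS e) yD sU.
have qD : q \in min_rcosets S (lam_up S e) by rewrite fixer_min_rcosets_up -?mem_lam_low.
have sL := subsetP (lam_up_sub e) s sU.
have spU : s * p \in <<lam_up S e>> by rewrite groupM // mem_gen.
rewrite yE mulgA !(length_min_rcosetsM cox (lamS e) _ zD) // ?ltn_add2r; last first.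
  by rewrite groupM // mem_gen.
by rewrite cE mulgA !(length_min_rcosetsM cox (lam_upS e) _ qD) // ltn_add2r.
Qed.

(** * Uniqueness of the forms and Green's relations *)

Lemma idempotent_form e y f z : e \in Lam -> f \in Lam -> y \in LR e -> z \in LR f ->
  uval y^-1 * e * uval y = uval z^-1 * f * uval z -> e = f /\ y = z.
Proof.
move=> eL fL yD zD eq.
(* Since [z * y^-1] conjugates [e] to [f], the transversal gives [e = f], and then [y] and [z] lie
   in the same coset of the commutant. *)
have conj : uval (z * y^-1) * e * uval (z * y^-1)^-1 = f.
  transitivity (uval z * (uval y^-1 * e * uval y) * uval z^-1).
    by rewrite invMg invgK !uvalM !mulgA.
  by rewrite eq -!mulgA uvalMV mulgA uvalMK.
have ef := Lam_conj eL fL conj; rewrite -ef in conj zD; split=> //.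
have cW : z * y^-1 \in <<lam S e>> by rewrite mem_lam //; apply/commutant_conj.
have [] := min_rcosets_inj cW (group1 _) yD zD => //.
by rewrite mulgKV mul1g.
Qed.

Lemma formP r : exists e x y, [/\ e \in Lam, y \in LR e & r = uval x * e * uval y].
Proof.
have [_ [e [w [eE ->]]]] := fac r.
case: (grc_transversal rc) => _ /(_ e eE)[f [[fL [v fE]] _]].
have -> : e = uval v^-1 * f * uval v by rewrite -fE -!mulgA uvalVM mulgA uvalMVK.
have [b [y [bW yD ->]]] := min_rcosets_decomposition cox (lamS f) v.
rewrite mem_lam // in bW; exists f, (w * (b * y)^-1 * b), y; split=> //.
by rewrite !uvalM -!mulgA (mulgA (uval b) f) (commutantE bW) -mulgA.
Qed.

Lemma star_mul_form x e y : e \in Lam ->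
  star (uval x * e * uval y) * (uval x * e * uval y) = uval y^-1 * e * uval y.
Proof.
move=> eL; rewrite (star_form fac semi) ?Lam_idempotent // -!mulgA uvalVM.
by rewrite idempotentMK ?Lam_idempotent.
Qed.

Lemma mul_star_form x e y : e \in Lam ->
  uval x * e * uval y * star (uval x * e * uval y) = uval x * e * uval x^-1.
Proof.
move=> eL; rewrite (star_form fac semi) ?Lam_idempotent // -!mulgA uvalMV.
by rewrite idempotentMK ?Lam_idempotent.
Qed.

Lemma greenL_form x e y x' e' y' : e \in Lam -> e' \in Lam -> y \in LR e -> y' \in LR e' ->
  greenL (uval x * e * uval y) (uval x' * e' * uval y') -> e = e' /\ y = y'.
Proof.
move=> eL e'L yD y'D; rewrite (greenL_star_mul fac semi) !star_mul_form // => /eqP.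
exact: idempotent_form.
Qed.

Lemma greenR_form x e y x' e' y' : e \in Lam -> e' \in Lam ->
  greenR (uval x * e * uval y) (uval x' * e' * uval y') ->
  e = e' /\ x^-1 * x' \in commutant e.
Proof.
move=> eL e'L; rewrite (greenR_mul_star fac semi) !mul_star_form // => /eqP eq.
have conj : uval (x^-1 * x') * e' * uval (x^-1 * x')^-1 = e.
  rewrite invMg invgK !uvalM.
  by rewrite -!mulgA (mulgA (uval x')) (mulgA (_ * e')) -eq -!mulgA uvalVM mulgA uvalMVK.
by have ee' := Lam_conj e'L eL conj; split=> //; apply/commutant_conj; rewrite -{1}ee'.
Qed.

(** After the outer units are stripped off, two idempotents in the same J-class remain; they are
    conjugate by a unit and therefore equal in the transversal. *)
Lemma greenJ_form x e y x' e' y' : e \in Lam -> e' \in Lam ->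
  greenJ (uval x * e * uval y) (uval x' * e' * uval y') -> e = e'.
Proof.
move=> eL e'L /greenJP[[u [v E]] [u' [v' E']]].
have [|w conj] := @greenJ_idempotent _ fac semi e' e (Lam_idempotent e'L) (Lam_idempotent eL).
  apply/greenJP; split.
    exists (uval x'^-1 * u' * uval x), (uval y * v' * uval y'^-1).
    transitivity (uval x'^-1 * (uval x' * e' * uval y') * uval y'^-1).
      by rewrite -!mulgA uvalVM mulgA uvalMK.
    by rewrite E' !mulgA.
  exists (uval x^-1 * u * uval x'), (uval y' * v * uval y^-1).
  transitivity (uval x^-1 * (uval x * e * uval y) * uval y^-1).
    by rewrite -!mulgA uvalVM mulgA uvalMK.
  by rewrite E !mulgA.
exact: (Lam_conj eL e'L conj).
Qed.

Lemma form_uniq x e y x' e' y' : e \in Lam -> e' \in Lam -> y \in LR e -> y' \in LR e' ->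
  uval x * e * uval y = uval x' * e' * uval y' ->
  [/\ e = e', y = y' & x^-1 * x' \in fixer e].
Proof.
move=> eL e'L yD y'D eq.
have gL : greenL (uval x * e * uval y) (uval x' * e' * uval y') by rewrite eq /greenL.
have gR : greenR (uval x * e * uval y) (uval x' * e' * uval y') by rewrite eq /greenR.
have [ee' yy'] := greenL_form eL e'L yD y'D gL; have [_ xW] := greenR_form eL e'L gR.
split=> //; rewrite mem_fixer xW andTb -(commutantE xW).
apply/eqP; rewrite -ee' -yy' in eq.
have xe : uval x * e = uval x' * e by rewrite -[LHS](uvalMK y) eq uvalMK.
by rewrite uvalM -mulgA -xe uvalVM.
Qed.

(** The witness is [w = 1]. The factor [a] may be arbitrary: its part in the fixer is absorbed by
    [e], and [x], being minimal modulo [lam_low], stays below [a] when that part is removed. *)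
Lemma adherence_plus_form e x a y b : e \in Lam ->
  x \in min_lcosets S (lam_low S e) -> y \in LR e -> b \in LR e ->
  bru x a -> bru b y -> le (uval x * e * uval y) (uval a * e * uval b).
Proof.
move=> eL xD yD bD xa yb.
have [a' [c [a'D cF aE]]] := min_lcosets_decomposition cox a (lam_lowS e).
have cF' : c \in fixer e by rewrite -mem_lam_low.
have -> : uval a * e * uval b = uval a' * e * uval b.
  by rewrite aE uvalM -(mulgA (uval a')) (fixerEl cF').
rewrite /adherence_plus; apply/existsP; exists x; apply/existsP; exists e.
apply/existsP; exists y; apply/existsP; exists a'; apply/existsP; exists e.
apply/existsP; exists b; rewrite /left_standard_form !eqxx eL xD yD a'D bD /=.
rewrite /idem_le idempotentE ?Lam_idempotent // eqxx /=.
apply/exists_inP; exists 1; first by rewrite -[1]mulg1 mem_mulg.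
rewrite mulg1 invg1 mul1g yb andbT.
have -> : a' = a * c^-1 by rewrite aE mulgK.
by apply: (bruhat_min_lcosets cox (lam_lowS e)); rewrite ?groupV.
Qed.

Lemma left_standard_form_uniq r x e y x' e' y' :
  left_standard_form Lam S r x e y -> left_standard_form Lam S r x' e' y' ->
  [/\ x = x', e = e' & y = y'].
Proof.
case/and4P=> /eqP rE eL xD yD /and4P[/eqP rE' e'L x'D y'D]; rewrite rE in rE'.
have [ee' yy' xx'] := form_uniq eL e'L yD y'D rE'; split=> //.
by rewrite -ee' in x'D; apply: (min_lcosets_inj cox xD x'D); rewrite mem_lam_low.
Qed.

(** The two idempotents agree, so both witnesses lie in W_lam(e). Additivity gives
    [len w + len b <= len y] and [len w' + len y <= len b]; both witnesses are trivial, and Bruhat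
    antisymmetry concludes. *)
Lemma adherence_plus_anti r s : le r s -> le s r -> r = s.
Proof.
have form r' s' : le r' s' -> exists x e y a f b w,
    [/\ left_standard_form Lam S r' x e y, left_standard_form Lam S s' a f b, idem_le e f,
        w \in <<lam_up S f>> * <<lam_low S e>> & bru x (a * w) && bru (w^-1 * b) y].
  case/existsP=> x /existsP[e /existsP[y /existsP[a /existsP[f /existsP[b]]]]].
  by case/and4P=> rx sa ef /exists_inP[w wU le_w]; exists x, e, y, a, f, b, w.
case/form=> x [e [y [a [f [b [w [rf sf /andP[_ /eqP fe] wU /andP[xaw wby]]]]]]]].
case/form=> a' [f' [b' [x' [e' [y' [w' [sf' rf' /andP[/eqP fe' _] wU' /andP[axw wyb]]]]]]]].
have [? ? ?] := left_standard_form_uniq rf rf'; subst x' e' y'.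
have [? ? ?] := left_standard_form_uniq sf sf'; subst a' f' b'.
have ef : e = f by rewrite -fe fe'.
case/and4P: rf sf => /eqP-> eL xD yD /and4P[/eqP-> _ aD bD].
rewrite -{}ef -?gen_lamM // in wU wU' bD *.
have wVW : w^-1 \in <<lam S e>> by rewrite groupV.
have wVW' : w'^-1 \in <<lam S e>> by rewrite groupV.
have lb := bruhat_length wby; have ly := bruhat_length wyb.
rewrite !(length_min_rcosetsM cox (lamS e)) // !(lengthV cox) in lb ly.
have lw : len w + len w' = 0.
  apply/eqP; rewrite -leqn0 -(leq_add2r (len b)) add0n addnAC.
  by apply: leq_trans ly; rewrite addnC leq_add2l.
have [lw0 lw0'] : len w = 0 /\ len w' = 0 by move/eqP: lw; rewrite addn_eq0 => /andP[/eqP ? /eqP].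
have w1 := length0 cox lw0; have w1' := length0 cox lw0'.
rewrite w1 w1' !mulg1 invg1 !mul1g in xaw wby axw wyb.
by rewrite (bruhat_anti xaw axw) (bruhat_anti wby wyb).
Qed.

Lemma greenL_same x x' e y : e \in Lam ->
  greenL (uval x * e * uval y) (uval x' * e * uval y).
Proof. by move=> eL; rewrite (greenL_star_mul fac semi) !star_mul_form. Qed.

Lemma greenR_same x x' e y y' : e \in Lam -> x^-1 * x' \in commutant e ->
  greenR (uval x * e * uval y) (uval x' * e * uval y').
Proof.
move=> eL; rewrite (greenR_mul_star fac semi) !mul_star_form // => /commutant_conj E.
by rewrite -{1}E invMg invgK !uvalM -!mulgA uvalMV -uvalM mulgV mulg1.
Qed.

Lemma greenJ_same x x' e y y' : greenJ (uval x * e * uval y) (uval x' * e * uval y').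
Proof.
apply/greenJP; split.
  by exists (uval (x * x'^-1)), (uval (y'^-1 * y)); rewrite !uvalM -!mulgA uvalVM uvalMV.
by exists (uval (x' * x^-1)), (uval (y^-1 * y')); rewrite !uvalM -!mulgA uvalVM uvalMV.
Qed.

(** * Normal forms and minima of the classes *)

Definition standard (P : R -> units_of R -> units_of R -> Prop) r : Prop :=
  exists e x y, [/\ e \in Lam, x \in LL e, y \in LR e, P e x y & r = uval x * e * uval y].

Definition normalO := standard (fun _ _ _ => True).
Definition normalGJ := standard (fun _ x _ => x = 1).
(* y w0 commutes with e iff y is the longest element of LR e. *)
Definition normalJG := standard (fun e _ y => y * w0 \in commutant e).
Definition normalN := standard (fun e x y => x = 1 /\ y * w0 \in commutant e).

Let w0K x : x * w0 * w0 = x.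
Proof. by rewrite -mulgA (longest_involution cox w0P) mulg1. Qed.

Let w0V : w0^-1 = w0.
Proof. by apply/eqP; rewrite eq_invg_mul (longest_involution cox w0P). Qed.

Let uw0K r : r * uval w0 * uval w0 = r.
Proof. by rewrite -mulgA -uvalM (longest_involution cox w0P) mulg1. Qed.

Let w0uK r : uval w0 * (uval w0 * r) = r.
Proof. by rewrite mulgA -uvalM (longest_involution cox w0P) mul1g. Qed.

(** The longest element of [LR e] is the minimal representative of the coset of [w0]. *)
Lemma exists_top e : e \in Lam -> exists2 y, y \in LR e & y * w0 \in commutant e.
Proof.
move=> eL; have [b [y [bW yD E]]] := min_rcosets_decomposition cox (lamS e) w0.
exists y; rewrite // -mem_lam //.
have -> : y * w0 = b^-1 by rewrite -[y](mulKg b) -E -mulgA (longest_involution cox w0P) mulg1.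
by rewrite groupV.
Qed.

(** The element [z] is in the coset of [w0], and [y], being minimal, stays below when [w0] is
    multiplied by elements of the commutant. *)
Lemma bruhat_top e y z : e \in Lam -> y \in LR e -> z * w0 \in commutant e -> bru y z.
Proof.
move=> eL yD zC; rewrite -[z]w0K; apply: (bruhat_min_rcosets cox (lamS e)) => //.
  by rewrite mem_lam.
exact: bruhat_longest.
Qed.

Lemma left_formP r : exists e x y,
  [/\ e \in Lam, x \in min_lcosets S (lam_low S e), y \in LR e & r = uval x * e * uval y].
Proof.
have [e [x [y [eL yD ->]]]] := formP r.
have [x' [c [x'D cF ->]]] := min_lcosets_decomposition cox x (lam_lowS e).
rewrite mem_lam_low // in cF; exists e, x', y; split=> //.
by rewrite uvalM -(mulgA (uval x')) (fixerEl cF).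
Qed.

Lemma LL_low e x : x \in LL e -> x \in min_lcosets S (lam_low S e).
Proof.
by rewrite !(min_lcosets_inv cox); apply: (subsetP (min_rcosetsS _ (lam_low_sub e))).
Qed.

Lemma LL1 e : 1 \in LL e. Proof. by rewrite (min_lcosets_inv cox) invg1 (min_rcosets1 cox). Qed.
Lemma LR1 e : 1 \in LR e. Proof. exact: (min_rcosets1 cox). Qed.
Hint Resolve LL1 LR1 bruhat_refl : core.

Lemma bruhat_LL e x x' : e \in Lam -> x \in LL e -> x^-1 * x' \in commutant e -> bru x x'.
Proof.
move=> eL xD xx'; rewrite -[x'](mulKVg x).
by apply: (bruhat_min_lcosets cox (lamS e)); rewrite ?mem_lam.
Qed.

Lemma normal_GJ_min m t : normalGJ m -> greenL m t -> le m t.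
Proof.
case=> e [x [y [eL xD yD -> ->]]]; have [e' [x' [y' [e'L x'D y'D ->]]]] := left_formP t.
case/greenL_form=> // ? ?; subst e' y'.
by apply: adherence_plus_form; rewrite ?LL_low ?bruhat1.
Qed.

Lemma normal_JG_min m t : normalJG m -> greenR m t -> le m t.
Proof.
case=> e [x [y [eL xD yD yT ->]]]; have [e' [x' [y' [e'L x'D y'D ->]]]] := left_formP t.
case/greenR_form=> // ? xx'; subst e'.
apply: adherence_plus_form => //; first exact: LL_low.
  exact: bruhat_LL eL _ _.
exact: bruhat_top eL _ _.
Qed.

Lemma normal_N_min m t : normalN m -> greenJ m t -> le m t.
Proof.
case=> e [x [y [eL xD yD [-> yT] ->]]]; have [e' [x' [y' [e'L x'D y'D ->]]]] := left_formP t.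
move/greenJ_form=> /(_ eL e'L) ?; subst e'.
by apply: adherence_plus_form => //; [apply: LL_low | apply: bruhat1 | apply: (bruhat_top eL)].
Qed.

Lemma normal_O_min m t : normalO m -> greenH m t -> le m t.
Proof.
case=> e [x [y [eL xD yD _ ->]]]; have [e' [x' [y' [e'L x'D y'D ->]]]] := left_formP t.
case/andP=> /greenL_form[] // ? ?; subst e' y' => /greenR_form[] // _ xx'.
by apply: adherence_plus_form => //; [apply: LL_low | apply: (bruhat_LL eL)].
Qed.

Lemma LL_decomposition e x : e \in Lam ->
  exists2 x', x' \in LL e & x^-1 * x' \in commutant e.
Proof.
move=> eL; have [x' [c [x'D cW ->]]] := min_lcosets_decomposition cox x (lamS e).
by exists x'; rewrite // invMg mulgKV -mem_lam ?groupV.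
Qed.

Lemma exists_GJ r : exists2 m, normalGJ m & greenL r m.
Proof.
have [e [x [y [eL yD ->]]]] := formP r; exists (uval 1 * e * uval y).
  by exists e, 1, y.
exact: greenL_same.
Qed.

Lemma exists_JG r : exists2 m, normalJG m & greenR r m.
Proof.
have [e [x [y [eL yD ->]]]] := formP r; have [x' x'D xx'] := LL_decomposition x eL.
have [z zD zT] := exists_top eL; exists (uval x' * e * uval z).
  by exists e, x', z.
exact: greenR_same.
Qed.

Lemma exists_N r : exists2 m, normalN m & greenJ r m.
Proof.
have [e [x [y [eL yD ->]]]] := formP r; have [z zD zT] := exists_top eL.
exists (uval 1 * e * uval z); last exact: greenJ_same.
by exists e, 1, z.
Qed.

Lemma exists_O r : exists2 m, normalO m & greenH r m.
Proof.
have [e [x [y [eL yD ->]]]] := formP r; have [x' x'D xx'] := LL_decomposition x eL.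
exists (uval x' * e * uval y); first by exists e, x', y.
by rewrite /greenH greenL_same // greenR_same.
Qed.

(** * Maxima of the classes *)

Lemma top_component e x : e \in Lam -> x * w0 \in commutant e -> x \in LR e ->
  {in <<lam S e>>, forall u, bru u (x * w0)}.
Proof.
move=> eL xT xD; apply: (longest_parabolic_component cox w0P (lamS e) xD _ (LR1 e)).
  by rewrite mem_lam.
by rewrite mulg1.
Qed.

Lemma normal_GJ_max m t : normalGJ (uval w0 * m) -> greenL m t -> le t m.
Proof.
case=> e [x [y [eL xD yD -> E]]]; have -> : m = uval w0 * e * uval y.
  by rewrite -[m]w0uK E !mulgA uval1 mulg1.
have [e' [x' [y' [e'L x'D y'D ->]]]] := left_formP t; case/greenL_form=> // ? ?; subst e' y'.
by apply: adherence_plus_form => //; apply: bruhat_longest.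
Qed.

(** With [y * w0 = b * z], the factor [b] is the longest element of W_lam(e) and passes through [e].
    Hence [m] is [x * b] times [e * z], and [x * b] is the greatest element of its left coset. *)
Lemma normal_O_max m t : normalO (m * uval w0) -> greenH m t -> le t m.
Proof.
case=> e [x [y [eL xD yD _ E]]].
have [b [z [bW zD yE]]] := min_rcosets_decomposition cox (lamS e) (y * w0).
have bC : b \in commutant e by rewrite -mem_lam.
have -> : m = uval (x * b) * e * uval z.
  rewrite -[m]uw0K E -!mulgA -uvalM yE !uvalM.
  by rewrite (mulgA e) -(commutantE bC) -!mulgA.
have [e' [x' [y' [e'L x'D y'D ->]]]] := left_formP t.
case/andP=> /greenL_form[] // ? ?; subst e' y' => /greenR_form[] // _ xx'.
apply: adherence_plus_form => //; apply: (bruhat_min_lcosets_top cox (lamS e)) => //.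
  exact: longest_parabolic_component yD bW zD yE.
have -> : x^-1 * x' = b * ((x * b)^-1 * x') by rewrite invMg !mulgA mulgV mul1g.
by rewrite groupM // mem_lam.
Qed.

(** Here [y * w0] is itself the longest element of W_lam(e) and passes through [e]. So [m] has the
    greatest left factor in its coset and the trivial right factor, which is best because [+]
    reverses right factors. *)
Lemma normal_JG_max m t : normalJG (m * uval w0) -> greenR m t -> le t m.
Proof.
case=> e [x [y [eL xD yD yT E]]]; have -> : m = uval (x * (y * w0)) * e * uval 1.
  by rewrite -[m]uw0K E -!mulgA -uvalM -(commutantE yT) !uvalM mulg1 -!mulgA.
have [e' [x' [y' [e'L x'D y'D ->]]]] := left_formP t; case/greenR_form=> // ? xx'; subst e'.
apply: adherence_plus_form; rewrite ?bruhat1 //.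
apply: (bruhat_min_lcosets_top cox (lamS e)) => //; rewrite ?mem_lam //.
  exact: top_component.
set b := y * w0 in yT xx' *.
have -> : x^-1 * x' = b * ((x * b)^-1 * x') by rewrite invMg !mulgA mulgV mul1g.
by rewrite -mem_lam // groupM ?mem_lam.
Qed.

Lemma Lam_max m t : uval w0 * m \in Lam -> greenJ m t -> le t m.
Proof.
move=> eL; set e := uval w0 * m in eL; have -> : m = uval w0 * e * uval 1.
  by rewrite mulg1 w0uK.
have [e' [x' [y' [e'L x'D y'D ->]]]] := left_formP t.
move/greenJ_form=> /(_ eL e'L) ?; subst e'.
by apply: adherence_plus_form; rewrite ?bruhat1 ?bruhat_longest.
Qed.

Lemma exists_GJ_max r : exists2 m, normalGJ (uval w0 * m) & greenL r m.
Proof.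
have [e [x [y [eL yD ->]]]] := formP r; exists (uval w0 * e * uval y); last exact: greenL_same.
by exists e, 1, y; split; rewrite // -!mulgA w0uK uval1 mul1g.
Qed.

Lemma exists_JG_max r : exists2 m, normalJG (m * uval w0) & greenR r m.
Proof.
have [m [e [x [y [eL xD yD yT ->]]]] rm] := exists_JG r.
exists (uval x * e * uval y * uval w0); first by rewrite uw0K; exists e, x, y.
rewrite -mulgA -uvalM; have [e' [x' [y' [e'L y'D rE]]]] := formP r.
rewrite rE in rm *; have [ee' xx'] := greenR_form e'L eL rm.
by rewrite -ee'; apply: greenR_same.
Qed.

Lemma exists_Lam_max r : exists2 m, uval w0 * m \in Lam & greenJ r m.
Proof.
have [e [x [y [eL yD ->]]]] := formP r; exists (uval w0 * e * uval 1); last exact: greenJ_same.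
by rewrite mulg1 w0uK.
Qed.

Lemma exists_O_max r : exists2 m, normalO (m * uval w0) & greenH r m.
Proof.
have [e [x [y [eL yD ->]]]] := formP r.
(* Since [z] represents the coset of [y * w0], the product [z * w0] lies in the coset of [y]. *)
have [c [z [cW zD E]]] := min_rcosets_decomposition cox (lamS e) (y * w0).
have cC : c^-1 \in commutant e by rewrite -mem_lam // groupV.
have [x' x'D xx'] := LL_decomposition x eL.
exists (uval x' * e * uval (z * w0)).
  by rewrite uvalM mulgA uw0K; exists e, x', z.
have zE : z * w0 = c^-1 * y by rewrite -[z](mulKg c) -E -mulgA w0K.
have -> : uval x' * e * uval (z * w0) = uval (x' * c^-1) * e * uval y.
  by rewrite zE !uvalM -!mulgA (mulgA e) -(commutantE cC) -!mulgA.
rewrite /greenH greenL_same // greenR_same // mulgA.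
by rewrite -mem_lam // groupM ?mem_lam.
Qed.

(** * Closure under restriction and products *)

Lemma chain e h : e \in Lam -> h \in idempotents R -> e * h = h ->
  exists g v, [/\ g \in Lam, v \in commutant e, e * g = g & h = uval v^-1 * g * uval v].
Proof.
move=> eL hE eh; have eE := Lam_idempotent eL.
have [|w [g [e' [gL e'L /andP[/eqP _ /eqP e'g] gE e'E]]]] := grc_chains rc hE eE.
  by rewrite /idem_le (idempotentC semi hE eE) eh eqxx.
(* The unit [w] conjugates [e] to an element of [Lam], which can only be [e] itself; so [w] commutes
   with [e]. *)
have ee' := Lam_conj eL e'L e'E; exists g, w; rewrite -ee' in e'g e'E.
split=> //; first exact/commutant_conj.
by rewrite -gE -!mulgA uvalVM mulgA uvalMVK.
Qed.

Lemma lam_up_le e g : e \in Lam -> g \in Lam -> e * g = g -> lam_up S g \subset lam S e.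
Proof.
move=> eL gL eg; apply: subset_trans (lam_up_sub e); apply: (grc_lam_up rc) => //.
by rewrite /idem_le (idempotentC semi (Lam_idempotent gL) (Lam_idempotent eL)) eg eqxx.
Qed.

(** Parts of the outer factors in the fixer are absorbed by [e], so minimality modulo [lam_up] is
    enough for a normal form. *)
Lemma normalO_up e x y : e \in Lam -> x^-1 \in min_rcosets S (lam_up S e) ->
  y \in min_rcosets S (lam_up S e) -> normalO (uval x * e * uval y).
Proof.
move=> eL /(min_rcosets_up eL)[b [z [bF zD xE]]] /(min_rcosets_up eL)[c [z' [cF z'D ->]]].
exists e, z^-1, z'; split; rewrite ?(mem_min_lcosetsV cox) //.
have bF' : b^-1 \in fixer e by rewrite -mem_lam_low // groupV mem_lam_low.
rewrite -[x]invgK xE invMg !uvalM -!mulgA (mulgA _ e) (fixerEl bF').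
by rewrite (mulgA e) (fixerE cF).
Qed.

Lemma normalO_star r : normalO r -> normalO (star r).
Proof.
case=> e [x [y [eL xD yD _ ->]]]; exists e, y^-1, x^-1; split=> //.
- by rewrite (mem_min_lcosetsV cox).
- by rewrite -(min_lcosets_inv cox).
exact: star_form (Lam_idempotent eL).
Qed.

Lemma LR_commutantM e g d y : e \in Lam -> y \in LR e -> d \in commutant e ->
  lam_up S g \subset lam S e -> d \in min_rcosets S (lam_up S g) ->
  d * y \in min_rcosets S (lam_up S g).
Proof.
move=> eL yD dC sub dD; apply: (ascent_min_rcosets cox (lam_upS g)) => s sU.
have sL := subsetP sub s sU; have dW : d \in <<lam S e>> by rewrite mem_lam.
have sdW : s * d \in <<lam S e>> by rewrite groupM // mem_gen.
rewrite mulgA !(length_min_rcosetsM cox (lamS e) _ yD) // ltn_add2r.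
exact: (min_rcosets_ascent cox (lam_upS g)).
Qed.

(** Moving [h] across [y] turns [r * h] into [x (e k) y] with [e k] below [e], and [e k] is
    conjugate to some [g] in [Lam] by a unit commuting with [e]. That unit is then distributed over
    [x] and [y]. *)
Lemma normalO_restrict r h : normalO r -> h \in idempotents R -> normalO (r * h).
Proof.
case=> e [x [y [eL xD yD _ ->]]] hE; have eE := Lam_idempotent eL.
have kE := idempotent_conj y hE; set k := uval y * h * uval y^-1 in kE.
have ekE : e * k \in idempotents R by apply: idempotentM.
have [|g [v [gL vC eg ekv]]] := chain eL ekE; first by rewrite idempotentMK.
have up := lam_up_le eL gL eg.
(* Only the minimal representative [d] of [v] modulo [lam_up] of [g] matters, as [c] commutes with
   [g]. It still commutes with [e] because [lam_up] of [g] is contained in [lam] of [e], and this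
   makes lengths add in [d * y] and [d * x^-1]. *)
have [c [d [cW dD vE]]] := min_rcosets_decomposition cox (lam_upS g) v.
have dC : d \in commutant e.
  rewrite -mem_lam // -(mulKg c d) -vE groupM ?groupV ?mem_lam // -mem_lam //.
  exact: (subsetP (genS up)).
have cC : c \in commutant g.
  by rewrite -mem_lam //; apply: (subsetP (genS (lam_up_sub g))).
have ekd : e * k = uval d^-1 * g * uval d.
  rewrite ekv vE invMg !uvalM -!mulgA (mulgA g) -(commutantE cC) -!mulgA.
  by rewrite uvalVM.
have -> : uval x * e * uval y * h = uval (x * d^-1) * g * uval (d * y).
  transitivity (uval x * (e * k) * uval y).
    by rewrite /k -!mulgA -[uval y^-1 * uval y]uvalM mulVg mulg1.
  by rewrite ekd !uvalM !mulgA.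
apply: normalO_up => //; last exact: (LR_commutantM eL).
by rewrite invMg invgK; apply: (LR_commutantM eL); rewrite // -(min_lcosets_inv cox).
Qed.

(** The restrictions [r * h] and [h * s] have the same inner idempotent [h]. Uniqueness of its form
    forces the right factor of the first to be inverse to the left factor of the second, so the
    middle cancels and the outer factors form a normal form. *)
Lemma normalO_mul r s : normalO r -> normalO s -> normalO (r * s).
Proof.
move=> rO sO; pose p := star r * r; pose q := s * star s; pose h := p * q.
have pE : p \in idempotents R by apply: idempotent_star_mul.
have qE : q \in idempotents R by apply: idempotent_mul_star.
have hE : h \in idempotents R by apply: idempotentM.
have rh : r * h = r * q by rewrite /h /p !mulgA mul_star_mul.
have hs : h * s = p * s by rewrite /h /q -!mulgA (mulgA s) mul_star_mul.
have := normalO_star (normalO_restrict (normalO_star sO) hE).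
rewrite (starM fac semi) (starK fac semi) (star_idempotent fac semi hE).
case=> e [x [y [eL xD yD _ hsE]]].
case: (normalO_restrict rO hE) => f [u [v [fL uD vD _ rhE]]].
have Eh : star (r * h) * (r * h) = h.
  rewrite (starM fac semi) (star_idempotent fac semi hE) -mulgA (mulgA _ r) -/p.
  by rewrite [p * h]idempotentMK // idempotentE.
have Eh' : h * s * star (h * s) = h.
  rewrite (starM fac semi) (star_idempotent fac semi hE) mulgA -(mulgA h) -/q.
  by rewrite -(mulgA p) idempotentE // idempotentE.
rewrite rhE star_mul_form // in Eh; rewrite hsE mul_star_form // in Eh'.
have xE : x^-1 \in LR e by rewrite -(min_lcosets_inv cox).
have [|fe vx] := idempotent_form fL eL vD xE; first by rewrite invgK Eh Eh'.
have -> : r * s = uval u * e * uval y.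
  transitivity (r * h * (h * s)).
    have rp : r * p = r by rewrite mulgA mul_star_mul.
    have qs : q * s = s by rewrite mul_star_mul.
    rewrite rh hs -(mulgA r) (mulgA q) (idempotentC semi qE pE).
    by rewrite -(mulgA p) qs mulgA rp.
  rewrite rhE hsE fe vx -!mulgA uvalVM idempotentMK ?Lam_idempotent //.
by rewrite fe in uD; exists e, u, y.
Qed.

Lemma normalO1 : normalO 1.
Proof. by exists 1, 1, 1; rewrite Lam1 LL1 LR1 uval1 !mulg1. Qed.

Lemma normalO_GJ r : normalGJ r -> normalO r.
Proof. by case=> e [x [y [? ? ? _ ?]]]; exists e, x, y. Qed.

Lemma normalO_JG r : normalJG r -> normalO r.
Proof. by case=> e [x [y [? ? ? _ ?]]]; exists e, x, y. Qed.

(** The idempotent [x e x^-1] has only one form, so if it lies in [Lam], its own trivial form gives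
    [x = 1]. *)
Lemma normalGJP r : normalGJ r <-> normalO r /\ r * star r \in Lam.
Proof.
split=> [rG|[[e [x [y [eL xD yD _ ->]]]]]].
  split; first exact: normalO_GJ.
  by case: rG => e [x [y [eL _ _ -> ->]]]; rewrite mul_star_form // invg1 uval1 mul1g mulg1.
rewrite mul_star_form //; set f := _ * uval x^-1 => fL.
have xD' : x^-1 \in LR e by rewrite -(min_lcosets_inv cox).
have [|_ x1] := idempotent_form eL fL xD' (LR1 f); first by rewrite !invgK invg1 uval1 mul1g mulg1.
by exists e, x, y; split=> //; rewrite -[x]invgK x1 invg1.
Qed.

(* Both e (y f y^-1) and its conjugate by y are W-conjugate into Lam below e
   and f; comparing the two conjugators produces an element of the double coset
   of y fixing the common representative g, so that y itself fixes g and
   e (y f y^-1) = g. *)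
Lemma Lam_double_coset e f y : e \in Lam -> f \in Lam -> y \in LR e -> y \in LL f ->
  e * (uval y * f * uval y^-1) \in Lam.
Proof.
move=> eL fL yD yD'; have [eE fE] := (Lam_idempotent eL, Lam_idempotent fL).
set k := uval y * f * uval y^-1; set h := e * k.
have hE : h \in idempotents R by rewrite idempotentM // idempotent_conj.
have [|g [v [gL vC eg hv]]] := chain eL hE; first by rewrite /h idempotentMK.
have eE' := idempotent_conj y^-1 eE; rewrite invgK in eE'.
have hE' := idempotent_conj y^-1 hE; rewrite invgK in hE'.
have hk : uval y^-1 * h * uval y = uval y^-1 * e * uval y * f.
  by rewrite /h /k -!mulgA -uvalM mulVg mulg1.
have [|g' [u [g'L uC fg' hu]]] := chain fL hE'.
  by rewrite hk (idempotentC semi eE' fE) idempotentMK.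
have gg' : uval (u * y^-1 * v^-1) * g * uval (u * y^-1 * v^-1)^-1 = g'.
  rewrite !invMg !invgK !uvalM.
  transitivity (uval u * (uval y^-1 * (uval v^-1 * g * uval v) * uval y) * uval u^-1).
    by rewrite !mulgA.
  by rewrite -hv hu -!mulgA uvalMV mulgA uvalMK.
have E := Lam_conj gL g'L gg'; rewrite -{g' g'L}E in fg' gg' hu.
have : (u * y^-1 * v^-1)^-1 \in <<lam S g>>.
  by rewrite groupV mem_lam //; apply/commutant_conj.
rewrite !invMg !invgK gen_lamM // => /mulsgP[a q aU qF pE].
have qE : q = a^-1 * v * y * u^-1 by rewrite -!mulgA pE mulKg.
have yq : bru y q.
  rewrite qE; apply: (bruhat_min_lcosets cox (lamS f)) => //; first by rewrite groupV mem_lam.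
  apply: (bruhat_min_rcosets cox (lamS e)) => //; rewrite groupM ?groupV ?mem_lam // -mem_lam //.
  exact: (subsetP (genS (lam_up_le eL gL eg))).
have yF : y \in fixer g.
  by rewrite -mem_lam_low //; apply: (bruhat_parabolic cox (lam_lowS g) yq).
have yF' : y^-1 \in fixer g by rewrite -mem_lam_low // groupV mem_lam_low.
have gE := Lam_idempotent gL.
have gh : h * g = g.
  by rewrite /h /k -!mulgA (fixerEl yF') fg' (fixerEl yF) eg.
(* So far [g] lies below [h]; equality follows because [h] is conjugate to [g] and has the same
   rank. *)
suff -> : h = g by [].
apply/esym/(idempotent_rank_eq semi gE hE gh).
by rewrite hv rank_mul.
Qed.

(** For [e y] and [f z], the left idempotent of the product is [e (y f y^-1)]. It depends only on
    the coset of [y] modulo the commutant of [f], so [y] may be replaced by its minimal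
    representative [y1]; as a length-additive left factor of [y], this is still in [LR e], hence
    minimal on both sides. *)
Lemma normalGJ_mul r s : normalGJ r -> normalGJ s -> normalGJ (r * s).
Proof.
move=> rG sG; apply/normalGJP; split; first by apply: normalO_mul; apply: normalO_GJ.
case: rG sG => e [x [y [eL _ yD -> ->]]] [f [_ [z [fL _ zD -> ->]]]].
rewrite uval1 !mul1g.
have [y1 [b [y1D bW yE]]] := min_lcosets_decomposition cox y (lamS f).
have y1D' : y1 \in LR e.
  apply: (min_rcosets_prefix cox (lamS e) (b := b)); first by rewrite -yE.
  exact: (length_min_lcosetsM cox (lamS f)).
suff -> : e * uval y * (f * uval z) * star (e * uval y * (f * uval z))
        = e * (uval y1 * f * uval y1^-1) by apply: Lam_double_coset.
have [eE fE] := (Lam_idempotent eL, Lam_idempotent fL).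
have bC : b \in commutant f by rewrite -mem_lam.
have kE := idempotent_conj y1 fE.
set k := uval y1 * f * uval y1^-1 in kE *.
have yk : uval y * f * uval y^-1 = k.
  rewrite /k yE invMg !uvalM -!mulgA (mulgA (uval b) f) (commutantE bC).
  by rewrite -!mulgA uvalMV.
transitivity (e * (uval y * f * uval y^-1) * e); last first.
  by rewrite yk -mulgA (idempotentC semi kE eE) idempotentMK.
rewrite !(starM fac semi) !(star_unit fac semi) !(star_idempotent fac semi) //.
by rewrite -!mulgA uvalMV (mulgA f f) idempotentE.
Qed.

(** * Conjugation by the longest element *)

Lemma conj_longest_form e x y : e \in Lam -> x \in LL e -> y \in LR e ->
  exists x' y', [/\ x' \in LL e, y' \in LR e, y * w0 * y'^-1 \in commutant e &
    uval w0 * (uval x * e * uval y) * uval w0 = uval x' * e * uval y'].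
Proof.
move=> eL xD yD; have xD' : x^-1 \in LR e by rewrite -(min_lcosets_inv cox).
have [c [x1 [cW x1D xE]]] := min_rcosets_decomposition cox (lamS e) (x^-1 * w0).
have [b [y1 [bW y1D yE]]] := min_rcosets_decomposition cox (lamS e) (y * w0).
have ctop := longest_parabolic_component cox w0P (lamS e) xD' cW x1D xE.
have btop := longest_parabolic_component cox w0P (lamS e) yD bW y1D yE.
(* Both components are the longest element of W_lam(e), so they coincide and cancel across [e], with
   which they commute. *)
have cb : c = b by apply: bruhat_anti; [apply: btop | apply: ctop].
have bC : b \in commutant e by rewrite -mem_lam.
exists x1^-1, y1; split=> //; first by rewrite (mem_min_lcosetsV cox).
  by rewrite yE mulgK.
have xE' : w0 * x = x1^-1 * b^-1 by rewrite -invMg -cb -xE invMg invgK w0V.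
transitivity (uval (w0 * x) * e * uval (y * w0)); first by rewrite !uvalM !mulgA.
by rewrite xE' yE !uvalM -!mulgA (mulgA e) -(commutantE bC) -!mulgA uvalVM.
Qed.

Lemma normalO_conj r : normalO r -> normalO (uval w0 * r * uval w0).
Proof.
case=> e [x [y [eL xD yD _ ->]]].
have [x' [y' [x'D y'D _ ->]]] := conj_longest_form eL xD yD.
by exists e, x', y'.
Qed.

(** Conjugation by [w0] turns the longest element of [LR e] into 1, because the new right factor
    lies both in [LR e] and in W_lam(e). With [star] this carries the closure of GJ over to JG. *)
Lemma normalJGP r : normalJG r <-> normalGJ (star (uval w0 * r * uval w0)).
Proof.
split=> [[e [x [y [eL xD yD yT ->]]]]|[e [x [y [eL _ yD -> E]]]]].
  have [x' [y' [x'D y'D y'C ->]]] := conj_longest_form eL xD yD.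
  have y'W : y' \in <<lam S e>>.
    rewrite -[y'](mulgKV (y * w0)) -[y' * _]invgK invMg invgK.
    by rewrite groupM ?groupV ?mem_lam.
  have [_ y1] := min_rcosets_inj (group1 _) y'W y'D (LR1 e) (etrans (mul1g _) (esym (mulg1 _))).
  exists e, 1, x'^-1; rewrite (star_form fac semi) ?Lam_idempotent // y1 invg1.
  by split; rewrite // -(min_lcosets_inv cox).
have conjE : uval w0 * r * uval w0 = uval y^-1 * e * uval 1.
  by rewrite -[LHS](starK fac semi) E (star_form fac semi) ?Lam_idempotent // invg1.
have rE : r = uval w0 * (uval y^-1 * e * uval 1) * uval w0.
  by rewrite -conjE -(mulgA _ r) w0uK uw0K.
have [||x' [y' [x'D y'D]]] := conj_longest_form (x := y^-1) (y := 1) eL.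
- by rewrite (mem_min_lcosetsV cox).
- exact: LR1.
rewrite mul1g -rE => wC ->; exists e, x', y'; split=> //.
by rewrite -mem_lam // -groupV invMg w0V mem_lam.
Qed.

Lemma normalGJ1 : normalGJ 1.
Proof. by exists 1, 1, 1; rewrite Lam1 LL1 LR1 uval1 !mulg1. Qed.

Lemma normalJG1 : normalJG 1.
Proof.
apply/normalJGP; rewrite mulg1 -uvalM (longest_involution cox w0P).
by rewrite (star_unit fac semi) invg1; apply: normalGJ1.
Qed.

Lemma normalJG_mul r s : normalJG r -> normalJG s -> normalJG (r * s).
Proof.
move=> /normalJGP rG /normalJGP sG; apply/normalJGP.
have -> : uval w0 * (r * s) * uval w0 = uval w0 * r * uval w0 * (uval w0 * s * uval w0).
  by rewrite -!mulgA w0uK.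
by rewrite (starM fac semi); apply: normalGJ_mul.
Qed.

Lemma normalNP r : normalN r <-> normalGJ r /\ normalJG r.
Proof.
split=> [[e [x [y [eL xD yD [x1 yT] ->]]]]|[]]; first by split; exists e, x, y.
case=> e [x [y [eL xD yD x1 ->]]] [e' [x' [y' [e'L x'D y'D y'T E]]]].
have [ee' yy' _] := form_uniq eL e'L yD y'D E; exists e, x, y; split=> //.
by rewrite ee' yy'.
Qed.

(** The two splittings are [(x e)(e y)] and, with [z] the longest element of [LR e],
    [(x e z)(z^-1 e y)]; they correspond to the two ways of pairing opposite signs. *)
Lemma normalO_factor r : normalO r ->
  (exists s t, [/\ normalGJ (star s), normalGJ t & r = s * t]) /\
  (exists s t, [/\ normalJG s, normalJG (star t) & r = s * t]).
Proof.
case=> e [x [y [eL xD yD _ ->]]]; have eE := Lam_idempotent eL.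
have xD' : x^-1 \in LR e by rewrite -(min_lcosets_inv cox).
have yD' : y^-1 \in LL e by rewrite (mem_min_lcosetsV cox).
split.
  exists (uval x * e * uval 1), (uval 1 * e * uval y); split.
  - by exists e, 1, x^-1; rewrite (star_form fac semi) // invg1.
  - by exists e, 1, y.
  by rewrite uval1 mulg1 mul1g -!mulgA idempotentMK.
have [z zD zT] := exists_top eL.
exists (uval x * e * uval z), (uval z^-1 * e * uval y); split.
- by exists e, x, z.
- by exists e, y^-1, z; rewrite (star_form fac semi) // invgK.
by rewrite -!mulgA uvalMV idempotentMK.
Qed.

(** * The order [-] and the sets for both signs *)

Lemma right_standard_formE r y e x :
  right_standard_form Lam S r y e x = left_standard_form Lam S (star r) x^-1 e y^-1.
Proof.
rewrite /right_standard_form /left_standard_form (mem_min_lcosetsV cox) (min_lcosets_inv cox).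
case eL: (e \in Lam); last by rewrite !andbF.
have eE := Lam_idempotent eL; rewrite [in RHS](andbC (x \in _)).
congr (_ && _); apply/eqP/eqP => [->|E]; first by rewrite (star_form fac semi).
by rewrite -[LHS](starK fac semi) E (star_form fac semi) // !invgK.
Qed.

Lemma adherence_minusE r s : adherence_minus Lam S r s = le (star r) (star s).
Proof.
apply/idP/idP.
  case/existsP=> y /existsP[e /existsP[x /existsP[b /existsP[f /existsP[a]]]]].
  rewrite !right_standard_formE => /and4P[rf sf ef /exists_inP[w wU /andP[xw wy]]].
  apply/existsP; exists x^-1; apply/existsP; exists e; apply/existsP; exists y^-1.
  apply/existsP; exists a^-1; apply/existsP; exists f; apply/existsP; exists b^-1.
  (* Inversion preserves Bruhat order and exchanges the two factors of the product of subgroups, so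
     the witness is inverted as well. *)
  rewrite rf sf ef; apply/exists_inP; exists w^-1; last first.
    by rewrite -!invMg !(bruhatV cox) xw wy.
  by case/mulsgP: wU => u v uU vU ->; rewrite invMg mem_mulg ?groupV.
case/existsP=> x /existsP[e /existsP[y /existsP[a /existsP[f /existsP[b]]]]].
rewrite -[x]invgK -[y]invgK -[a]invgK -[b]invgK -!right_standard_formE.
case/and4P=> rf sf ef /exists_inP[w wU /andP[xw wy]].
apply/existsP; exists y^-1; apply/existsP; exists e; apply/existsP; exists x^-1.
apply/existsP; exists b^-1; apply/existsP; exists f; apply/existsP; exists a^-1.
rewrite rf sf ef; apply/exists_inP; exists w^-1.
  by case/mulsgP: wU => u v uU vU ->; rewrite invMg mem_mulg ?groupV.
by rewrite -(bruhatV cox) -[in X in _ && X](bruhatV cox) !invMg !invgK in xw wy *; rewrite xw wy.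
Qed.

Lemma mins_star (G1 G2 : rel R) r : (forall s t, G1 s t = G2 (star s) (star t)) ->
  (r \in mins (adherence_minus Lam S) G1) = (star r \in mins le G2).
Proof.
move=> G12; rewrite !inE; apply/forall_inP/forall_inP => lemin t; rewrite inE.
  by move=> Gt; rewrite -[t](starK fac semi) -adherence_minusE lemin // inE G12 starK.
by rewrite G12 adherence_minusE => Gt; rewrite lemin // inE.
Qed.

Lemma maxs_star (G1 G2 : rel R) r : (forall s t, G1 s t = G2 (star s) (star t)) ->
  (r \in maxs (adherence_minus Lam S) G1) = (star r \in maxs le G2).
Proof.
move=> G12; rewrite !inE; apply/forall_inP/forall_inP => lemax t; rewrite inE.
  by move=> Gt; rewrite -[t](starK fac semi) -adherence_minusE lemax // inE G12 starK.
by rewrite G12 adherence_minusE => Gt; rewrite lemax // inE.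
Qed.

Lemma class_representatives_star (G1 G2 : rel R) (X Y : {set R}) :
  (forall s t, G1 s t = G2 (star s) (star t)) -> (forall r, (r \in X) = (star r \in Y)) ->
  class_representatives G2 Y -> class_representatives G1 X.
Proof.
move=> G12 XY repY r; have [s [[sY]]] := repY (star r); rewrite inE => rs uniq.
exists (star s); split; first by rewrite XY inE G12 (starK fac semi).
move=> t []; rewrite XY inE G12 => tY rt; apply: (inv_inj (starK fac semi)).
by rewrite (starK fac semi); apply: uniq; rewrite inE.
Qed.

Lemma setGJP eps r : r \in setGJ Lam S eps <->
  if eps is Plus then normalGJ r else normalJG (star r).
Proof.
have symL : symmetric (@greenL R) by move=> s t; apply: eq_sym.
have symR : symmetric (@greenR R) by move=> s t; apply: eq_sym.
case: eps; first exact: (minsP adherence_plus_anti symL exists_GJ normal_GJ_min).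
rewrite /setGJ (mins_star _ (G2 := @greenR R)); last exact: (greenL_star fac semi).
exact: (minsP adherence_plus_anti symR exists_JG normal_JG_min).
Qed.

Lemma setJGP eps r : r \in setJG Lam S eps <->
  if eps is Plus then normalJG r else normalGJ (star r).
Proof.
have symL : symmetric (@greenL R) by move=> s t; apply: eq_sym.
have symR : symmetric (@greenR R) by move=> s t; apply: eq_sym.
case: eps; first exact: (minsP adherence_plus_anti symR exists_JG normal_JG_min).
rewrite /setJG (mins_star _ (G2 := @greenL R)); last exact: (greenR_star fac semi).
exact: (minsP adherence_plus_anti symL exists_GJ normal_GJ_min).
Qed.

Lemma setNP eps r : r \in setN Lam S eps <->
  if eps is Plus then normalN r else normalN (star r).
Proof.
have symJ : symmetric (@greenJ R) by move=> s t; apply: eq_sym.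
case: eps; first exact: (minsP adherence_plus_anti symJ exists_N normal_N_min).
rewrite /setN (mins_star _ (G2 := @greenJ R)); last exact: (greenJ_star fac semi).
exact: (minsP adherence_plus_anti symJ exists_N normal_N_min).
Qed.

Lemma normalO_starE r : normalO (star r) <-> normalO r.
Proof.
split=> [rO|]; last exact: normalO_star.
by rewrite -[r](starK fac semi); apply: normalO_star.
Qed.

Lemma greenH_sym : symmetric (@greenH R).
Proof. by move=> s t; rewrite /greenH /greenL /greenR eq_sym [X in _ && X]eq_sym. Qed.

Lemma setOP eps r : r \in setO Lam S eps <-> normalO r.
Proof.
case: eps; first exact: (minsP adherence_plus_anti greenH_sym exists_O normal_O_min).
rewrite /setO (mins_star _ (G2 := @greenH R)); last exact: (greenH_star fac semi).
split=> [/(minsP adherence_plus_anti greenH_sym exists_O normal_O_min)/normalO_starE //|].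
move/normalO_starE=> rO; exact/(minsP adherence_plus_anti greenH_sym exists_O normal_O_min).
Qed.

Lemma mem_ltrans_longest (X : {set R}) r : (r \in ltrans (uval w0) X) = (uval w0 * r \in X).
Proof.
apply/imsetP/idP => [[s sX ->]|rX]; first by rewrite w0uK.
by exists (uval w0 * r); rewrite ?w0uK.
Qed.

Lemma mem_rtrans_longest (X : {set R}) r : (r \in rtrans X (uval w0)) = (r * uval w0 \in X).
Proof.
apply/imsetP/idP => [[s sX ->]|rX]; first by rewrite uw0K.
by exists (r * uval w0); rewrite ?uw0K.
Qed.

Let greenL_sym : symmetric (@greenL R). Proof. by move=> s t; apply: eq_sym. Qed.
Let greenR_sym : symmetric (@greenR R). Proof. by move=> s t; apply: eq_sym. Qed.
Let greenJ_sym : symmetric (@greenJ R). Proof. by move=> s t; apply: eq_sym. Qed.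
Let greenL_trans : transitive (@greenL R).
Proof. by move=> s r t /eqP E /eqP E'; rewrite /greenL E E'. Qed.
Let greenR_trans : transitive (@greenR R).
Proof. by move=> s r t /eqP E /eqP E'; rewrite /greenR E E'. Qed.
Let greenJ_trans : transitive (@greenJ R).
Proof. by move=> s r t /eqP E /eqP E'; rewrite /greenJ E E'. Qed.
Let greenH_trans : transitive (@greenH R).
Proof.
move=> s r t /andP[rsL rsR] /andP[stL stR].
by apply/andP; split; [apply: greenL_trans stL | apply: greenR_trans stR].
Qed.

Lemma max_greenLP eps r : r \in maxs (adherence eps Lam S) (@greenL R) <->
  uval w0 * r \in setGJ Lam S eps.
Proof.
case: eps; last rewrite (maxs_star _ (G2 := @greenR R)); last exact: (greenL_star fac semi).
  apply: (iff_trans (maxsP adherence_plus_anti greenL_sym exists_GJ_max normal_GJ_max r)).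
  exact: iff_sym (setGJP Plus _).
apply: (iff_trans (maxsP adherence_plus_anti greenR_sym exists_JG_max normal_JG_max _)).
apply: iff_sym (iff_trans (setGJP Minus _) _).
by rewrite (starM fac semi) (star_unit fac semi) w0V.
Qed.

Lemma max_greenRP eps r : r \in maxs (adherence eps Lam S) (@greenR R) <->
  r * uval w0 \in setJG Lam S eps.
Proof.
case: eps; last rewrite (maxs_star _ (G2 := @greenL R)); last exact: (greenR_star fac semi).
  apply: (iff_trans (maxsP adherence_plus_anti greenR_sym exists_JG_max normal_JG_max r)).
  exact: iff_sym (setJGP Plus _).
apply: (iff_trans (maxsP adherence_plus_anti greenL_sym exists_GJ_max normal_GJ_max _)).
apply: iff_sym (iff_trans (setJGP Minus _) _).
by rewrite (starM fac semi) (star_unit fac semi) w0V.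
Qed.

Lemma Lam_star r : (star r \in Lam) = (r \in Lam).
Proof.
apply/idP/idP => rL; have := star_idempotent fac semi (Lam_idempotent rL); last by move->.
by rewrite (starK fac semi) => ->.
Qed.

Lemma max_greenJP eps r : r \in maxs (adherence eps Lam S) (@greenJ R) <->
  (if eps is Plus then uval w0 * r \in Lam else r * uval w0 \in Lam).
Proof.
case: eps; last rewrite (maxs_star _ (G2 := @greenJ R)); last exact: (greenJ_star fac semi).
  exact: (maxsP adherence_plus_anti greenJ_sym exists_Lam_max Lam_max r).
apply: (iff_trans (maxsP adherence_plus_anti greenJ_sym exists_Lam_max Lam_max _)).
by rewrite -{1}w0V -(star_unit fac semi) -(starM fac semi) Lam_star.
Qed.

Lemma normalO_longestC r : normalO (uval w0 * r) <-> normalO (r * uval w0).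
Proof.
split=> /normalO_conj; first by rewrite w0uK.
by rewrite -mulgA uw0K.
Qed.

Lemma max_greenHP eps r : r \in maxs (adherence eps Lam S) (@greenH R) <->
  normalO (r * uval w0).
Proof.
case: eps; last rewrite (maxs_star _ (G2 := @greenH R)); last exact: (greenH_star fac semi).
  exact: (maxsP adherence_plus_anti greenH_sym exists_O_max normal_O_max r).
apply: (iff_trans (maxsP adherence_plus_anti greenH_sym exists_O_max normal_O_max _)).
rewrite -{1}w0V -(star_unit fac semi) -(starM fac semi).
exact: iff_trans (normalO_starE _) (normalO_longestC _).
Qed.

Lemma class_representatives_GJ eps : class_representatives (@greenL R) (setGJ Lam S eps).
Proof.
case: eps.
  exact: (class_representatives_mins adherence_plus_anti greenL_sym
    greenL_trans exists_GJ normal_GJ_min).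
apply: (class_representatives_star (greenL_star fac semi) _
  (class_representatives_mins adherence_plus_anti greenR_sym
    greenR_trans exists_JG normal_JG_min)).
by move=> r; apply/mins_star/greenL_star.
Qed.

Lemma class_representatives_JG eps : class_representatives (@greenR R) (setJG Lam S eps).
Proof.
case: eps.
  exact: (class_representatives_mins adherence_plus_anti greenR_sym
    greenR_trans exists_JG normal_JG_min).
apply: (class_representatives_star (greenR_star fac semi) _
  (class_representatives_mins adherence_plus_anti greenL_sym
    greenL_trans exists_GJ normal_GJ_min)).
by move=> r; apply/mins_star/greenR_star.
Qed.

Lemma class_representatives_N eps : class_representatives (@greenJ R) (setN Lam S eps).
Proof.
case: eps.
  exact: (class_representatives_mins adherence_plus_anti greenJ_sym
    greenJ_trans exists_N normal_N_min).
apply: (class_representatives_star (greenJ_star fac semi) _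
  (class_representatives_mins adherence_plus_anti greenJ_sym
    greenJ_trans exists_N normal_N_min)).
by move=> r; apply/mins_star/greenJ_star.
Qed.

Lemma class_representatives_O : class_representatives (@greenH R) (setO Lam S Plus).
Proof.
exact: (class_representatives_mins adherence_plus_anti greenH_sym
    greenH_trans exists_O normal_O_min).
Qed.

(** * Submonoids and factorizations *)

Lemma setNE eps : setN Lam S eps = setGJ Lam S eps :&: setJG Lam S eps.
Proof.
apply/setP => r; rewrite in_setI; apply/idP/andP.
  by case: eps => /setNP/normalNP[? ?]; split; apply/setGJP || apply/setJGP.
by case=> /setGJP + /setJGP; case: eps => ? ?; apply/setNP/normalNP.
Qed.

Lemma submonoid_GJ eps : submonoid (setGJ Lam S eps).
Proof.
split=> [|r s /setGJP rG /setGJP sG]; apply/setGJP.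
  case: eps; first exact: normalGJ1.
  by rewrite (star_idempotent fac semi (idempotent1 R)); apply: normalJG1.
case: eps rG sG => rG sG; first exact: normalGJ_mul.
by rewrite (starM fac semi); apply: normalJG_mul.
Qed.

Lemma submonoid_JG eps : submonoid (setJG Lam S eps).
Proof.
split=> [|r s /setJGP rG /setJGP sG]; apply/setJGP.
  case: eps; first exact: normalJG1.
  by rewrite (star_idempotent fac semi (idempotent1 R)); apply: normalGJ1.
case: eps rG sG => rG sG; first exact: normalJG_mul.
by rewrite (starM fac semi); apply: normalGJ_mul.
Qed.

Lemma submonoid_N eps : submonoid (setN Lam S eps).
Proof.
have [gj1 gjM] := submonoid_GJ eps; have [jg1 jgM] := submonoid_JG eps.
rewrite setNE; split=> [|r s]; first by rewrite in_setI gj1 jg1.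
by rewrite !in_setI => /andP[? ?] /andP[? ?]; rewrite gjM ?jgM.
Qed.

Lemma submonoid_O : submonoid (setO Lam S Plus).
Proof.
split=> [|r s /setOP rO /setOP sO]; apply/setOP; first exact: normalO1.
exact: normalO_mul.
Qed.

Lemma inverse_submonoid_O : inverse_submonoid (setO Lam S Plus).
Proof.
split=> [|r /setOP rO]; first exact: submonoid_O.
exists (star r); split; first by split; [apply/setOP/normalO_star | apply: star_weak_inverse].
by move=> s [_ /(star_eq fac semi)].
Qed.

(** Weak inverses are unique in [R], so the inverse provided inside [M] is [star r]. *)
Lemma inverse_submonoid_star (M : {set R}) r : inverse_submonoid M -> r \in M -> star r \in M.
Proof. by case=> _ invM /invM[s [[sM /(star_eq fac semi) ->] _]]. Qed.

Lemma setGJ_sub_O eps : setGJ Lam S eps \subset setO Lam S Plus.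
Proof.
apply/subsetP => r /setGJP; case: eps => [/normalO_GJ|/normalO_JG/normalO_starE] rO;
  exact/setOP.
Qed.

Lemma setJG_sub_O eps : setJG Lam S eps \subset setO Lam S Plus.
Proof.
apply/subsetP => r /setJGP; case: eps => [/normalO_JG|/normalO_GJ/normalO_starE] rO;
  exact/setOP.
Qed.

Lemma setO_factor eps r : r \in setO Lam S Plus -> exists s t,
  [/\ s \in setJG Lam S (opp_sign eps), t \in setGJ Lam S eps & r = s * t].
Proof.
case/setOP/normalO_factor=> [[s [t [sG tG rE]]] [s' [t' [sG' tG' rE']]]].
by case: eps; [exists s, t | exists s', t']; split=> //; apply/setJGP || apply/setGJP.
Qed.

Lemma mem_star_GJ eps r : (star r \in setGJ Lam S eps) = (r \in setJG Lam S (opp_sign eps)).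
Proof.
by apply/idP/idP => [/setGJP rG|/setJGP rG]; [apply/setJGP|apply/setGJP]; move: rG;
  case: eps; rewrite ?(starK fac semi).
Qed.

Lemma mem_star_JG eps r : (star r \in setJG Lam S eps) = (r \in setGJ Lam S (opp_sign eps)).
Proof.
by apply/idP/idP => [/setJGP rG|/setGJP rG]; [apply/setGJP|apply/setJGP]; move: rG;
  case: eps; rewrite ?(starK fac semi).
Qed.

End RennerCoxeter.

Theorem corollary5p4 (R : finMonoidType) (Lam : {set R}) (S : {set units_of R})
    (w0 : units_of R) (rc : generalized_renner_coxeter Lam S)
    (w0P : longest S w0) :
  let GJ eps := setGJ Lam S eps in
  let JG eps := setJG Lam S eps in
  let N eps := setN Lam S eps in
  let O := setO Lam S Plus in
  let LamN := ltrans (uval w0) (rtrans Lam (uval w0)) in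
  let leq eps := adherence eps Lam S in
  (* (1) *) setO Lam S Plus = setO Lam S Minus /\
  (* (2) *) (forall eps, N eps = GJ eps :&: JG eps) /\
  (* (3) *) ((forall eps, [/\ submonoid (GJ eps), submonoid (JG eps)
                            & submonoid (N eps)]) /\ submonoid O) /\
  (* (4) *) (GJ Plus = [set star r | r in JG Minus] /\
             JG Plus = [set star r | r in GJ Minus]) /\
  (* (5) The signs: for a single eps the submonoid generated by GJ eps and
     JG eps is in general a proper submonoid of O (already for the rook monoid
     of degree 2). The property holds with both signs together, and also for
     the pairs GJ eps, JG (opp_sign eps). *)
             (smallest (fun M : {set R} =>
                submonoid M /\
                forall eps, GJ eps \subset M /\ JG eps \subset M) O /\
              forall eps, smallest (fun M : {set R} =>
                [/\ submonoid M, GJ eps \subset M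
                  & JG (opp_sign eps) \subset M]) O) /\
  (* (6) *) (forall eps, smallest (fun M : {set R} =>
               inverse_submonoid M /\ GJ eps \subset M) O) /\
  (* (7) *) (forall eps, smallest (fun M : {set R} =>
               inverse_submonoid M /\ JG eps \subset M) O) /\
  (* (8) *) (forall eps,
               ltrans (uval w0) (GJ eps) = maxs (leq eps) (@greenL R)) /\
  (* (9) *) (forall eps,
               rtrans (JG eps) (uval w0) = maxs (leq eps) (@greenR R)) /\
  (* (10) *) ([/\ ltrans (uval w0) Lam = rtrans LamN (uval w0)
                & rtrans LamN (uval w0) = maxs (leq Plus) (@greenJ R)] /\
              [/\ ltrans (uval w0) LamN = rtrans Lam (uval w0)
                & rtrans Lam (uval w0) = maxs (leq Minus) (@greenJ R)]) /\
  (* (11) *) (ltrans (uval w0) O = rtrans O (uval w0) /\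
              forall eps, rtrans O (uval w0) = maxs (leq eps) (@greenH R)) /\
  (* (12) *) ((forall eps, [/\ class_representatives (@greenJ R) (N eps),
                               class_representatives (@greenL R) (GJ eps)
                             & class_representatives (@greenR R) (JG eps)]) /\
              class_representatives (@greenH R) O).
Proof.
move=> GJ JG N O LamN leq.
have fac := grc_factorizable rc; have semi := grc_semilattice rc.
split; first by apply/setP => r; apply/idP/idP => /(setOP rc) rO; apply/(setOP rc).
split; first exact: (setNE rc w0P).
split.
  split; last exact: submonoid_O.
  by split; [apply: submonoid_GJ rc w0P _ | apply: submonoid_JG rc w0P _
            | apply: submonoid_N rc w0P _].
split.
  by split; apply/setP => r; rewrite (mem_star_image fac semi)
    ?(mem_star_JG rc w0P) ?(mem_star_GJ rc w0P).
(* All minimality claims go through this: each element of [O] is a product of one from [JG] and one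
   from [GJ] of opposite signs. *)
have factor eps (M : {set R}) : submonoid M -> GJ eps \subset M ->
    JG (opp_sign eps) \subset M -> O \subset M.
  case=> _ MM /subsetP gjM /subsetP jgM; apply/subsetP => r.
  by case/(setO_factor rc w0P eps)=> s [t [/jgM sM /gjM tM ->]]; apply: MM.
have GJO := setGJ_sub_O rc w0P; have JGO := setJG_sub_O rc w0P.
have monO := submonoid_O rc; have invO := inverse_submonoid_O rc.
split.
  split=> [|eps]; split=> [|M [Mmon]].
  - by split.
  - move=> subM; have [gjM _] := subM Plus; have [_ jgM] := subM Minus.
    exact: (factor Plus M Mmon gjM jgM).
  - by split.
  by move=> gjM jgM; apply: (factor eps M Mmon gjM jgM).
split=> [eps|].
  split=> [|M [Minv gjM]]; first by split.
  apply: (factor eps) => //; first by case: Minv.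
  (* An inverse submonoid is closed under [star], and the images of [GJ eps] under [star] make up
     [JG (opp_sign eps)]. *)
  apply/subsetP => r; rewrite -(mem_star_GJ rc w0P) => /(subsetP gjM).
  by move/(inverse_submonoid_star rc Minv); rewrite (starK fac semi).
split=> [eps|].
  split=> [|M [Minv jgM]]; first by split.
  have oppK : opp_sign (opp_sign eps) = eps by case: (eps).
  apply: (factor (opp_sign eps)); rewrite ?oppK //; first by case: Minv.
  apply/subsetP => r; rewrite -(mem_star_JG rc w0P) => /(subsetP jgM).
  by move/(inverse_submonoid_star rc Minv); rewrite (starK fac semi).
have memL := mem_ltrans_longest rc w0P; have memR := mem_rtrans_longest rc w0P.
have w0K : uval w0 * uval w0 = 1.
  by rewrite -uvalM (longest_involution (grc_coxeter rc) w0P).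
have rw0K r : r * uval w0 * uval w0 = r by rewrite -mulgA w0K mulg1.
have w0rK r : uval w0 * (uval w0 * r) = r by rewrite mulgA w0K mul1g.
split=> [eps|].
  by apply/setP => r; rewrite memL; apply/idP/idP => /(max_greenLP rc w0P).
split=> [eps|].
  by apply/setP => r; rewrite memR; apply/idP/idP => /(max_greenRP rc w0P).
have memLamN r : (r \in LamN) = (uval w0 * r * uval w0 \in Lam) by rewrite memL memR.
split.
  split; split; apply/setP => r;
    rewrite ?(memL, memR, memLamN) ?(mulgA (uval w0) r) ?(w0rK, rw0K) //.
    by apply/idP/idP => /(max_greenJP rc w0P Plus).
  by apply/idP/idP => /(max_greenJP rc w0P Minus).
split.
  split=> [|eps]; apply/setP => r; rewrite ?(memL, memR).
    by apply/idP/idP => /(setOP rc)/(normalO_longestC rc w0P) rO; apply/(setOP rc).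
  apply/idP/idP => [/(setOP rc) rO|/(max_greenHP rc w0P) rO]; last exact/(setOP rc).
  exact/(max_greenHP rc w0P).
split=> [eps|]; last exact: class_representatives_O.
by split; [apply: class_representatives_N rc w0P _ | apply: class_representatives_GJ rc w0P _
          | apply: class_representatives_JG rc w0P _].
Qed.
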